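(* Let $\Delta$ be a simplicial complex, let $J\subseteq\mathbb{R}$, and let $\{\Delta^\ell\}_{\ell\in J}$ be a filtration of $\Delta$ as a topological space (so $\Delta^{\ell}\subset\Delta^{\ell'}$ whenever $\ell<\ell'$) such that each $\Delta^\ell$ is also a simplicial complex. Let $I$ be an index set and, for each $\ell\in J$, let $(\Delta^\ell_i)_{i\in I}$ be a locally finite family of subcomplexes of $\Delta^\ell$ such that $\Delta^\ell=\bigcup_{i\in I}\Delta^\ell_i$ and every nonempty finite intersection $\Delta^\ell_{i_1}\cap\cdots\cap\Delta^\ell_{i_t}$ is contractible. Suppose that $\ell,\ell+p\in J$ with $p>0$ are such that, for every $i\in I$, $\Delta^\ell_i$ is a subcomplex of $\Delta^{\ell+p}_i$. Then for each $k\in\mathbb{N}$, $$H_k^p(\Delta^\ell)\;\cong\; H_k^p(\mathcal{N}(\Delta^\ell_i)),$$ where $\mathcal{N}(\Delta^\ell_i)$ is the nerve of the collection $(\Delta^\ell_i)_{i\in I}$; that is, the $p$-persistent $k$-th homology groups at level $\ell$ of the filtrations $\Delta^\ell\subset\Delta^{\ell+p}$ and $\mathcal{N}(\Delta^\ell_i)\subset\mathcal{N}(\Delta^{\ell+p}_i)$ coincide up to isomorphism.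
   Context: Homology is simplicial homology with a fixed coefficient ring; $C_k(X)$, $Z_k(X)$, $B_k(X)$ denote the $k$-chains, $k$-cycles and $k$-boundaries of a simplicial complex $X$. Persistent homology: for a filtered space with $X^\ell\subset X^{\ell+p}$, the $p$-persistent $k$-th homology $H_k^p(X^\ell)$ is the image of $H_k(X^\ell)$ in $H_k(X^{\ell+p})$ under the map induced by inclusion; equivalently $$H_k^p(X^\ell)=\frac{Z_k(X^\ell)}{B_k(X^{\ell+p})\cap Z_k(X^\ell)}.$$ Nerve: the nerve $\mathcal{N}(\Delta^\ell_i)$ of the family $(\Delta^\ell_i)_{i\in I}$ is the simplicial complex whose simplices are the nonempty finite subsets $\{i_1,\dots,i_t\}\subset I$ with $\Delta^\ell_{i_1}\cap\cdots\cap\Delta^\ell_{i_t}\neq\emptyset$. Under the hypothesis that $\Delta^\ell_i$ is a subcomplex of $\Delta^{\ell+p}_i$ for every $i$, $\mathcal{N}(\Delta^\ell_i)$ is a subcomplex of $\mathcal{N}(\Delta^{\ell+p}_i)$, and $H_k^p(\mathcal{N}(\Delta^\ell_i))$ is computed with respect to this inclusion. Locally finite family: each vertex of $\Delta^\ell$ belongs to only finitely many of the $\Delta^\ell_i$. *)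

(* Defs.v *)
From HB Require Import structures.
From mathcomp Require Import all_boot all_order all_algebra perm finmap.
From mathcomp Require Import all_classical all_reals all_analysis.
Import Order.TTheory GRing.Theory Num.Theory numFieldNormedType.Exports.

Set Implicit Arguments.
Unset Strict Implicit.
Unset Printing Implicit Defensive.

Local Open Scope fset_scope.
Local Open Scope classical_set_scope.
Local Open Scope ring_scope.

(** * Simplicial complexes *)

(* [V] is only a type of labels: the vertices of [K] are the [v] such that
   [K [fset v]]. The empty complex is allowed. *)
Record complex (V : choiceType) := Complex {
  simplex :> {fset V} -> Prop;
  simplex_neq0 : forall s, simplex s -> s != fset0;
  simplex_face : forall s t : {fset V},
    simplex s -> (t `<=` s)%fset -> t != fset0 -> simplex t
}.

Section Intersection.
Context {I V : choiceType} (F : I -> complex V).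

Definition inter_simplex (s : {fset I}) : set {fset V} :=
  [set t | t != fset0 /\ forall i, i \in s -> F i t].

Lemma inter_simplex_neq0 s t : inter_simplex s t -> t != fset0.
Proof. by case. Qed.

Lemma inter_simplex_face s (t u : {fset V}) :
  inter_simplex s t -> (u `<=` t)%fset -> u != fset0 -> inter_simplex s u.
Proof.
move=> [_ Ft] ut u0; split=> // i si.
exact: simplex_face (Ft i si) ut u0.
Qed.

Definition inter (s : {fset I}) : complex V :=
  Complex (@inter_simplex_neq0 s) (@inter_simplex_face s).

Definition nerve_simplex : set {fset I} :=
  [set s | s != fset0 /\ exists t, inter s t].

Lemma nerve_simplex_neq0 s : nerve_simplex s -> s != fset0.
Proof. by case. Qed.

Lemma nerve_simplex_face (s t : {fset I}) :
  nerve_simplex s -> (t `<=` s)%fset -> t != fset0 -> nerve_simplex t.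
Proof.
move=> [_ [u [u0 Fu]]] ts t0; split=> //; exists u; split=> // i ti.
by apply: Fu; exact: (fsubsetP ts).
Qed.

Definition nerve : complex I :=
  Complex nerve_simplex_neq0 nerve_simplex_face.

End Intersection.

(** * Geometric realization *)

(* A point is given by its barycentric coordinates. *)
Record realization (R : realType) (V : choiceType) (K : complex V) := Point {
  bary :> V -> R;
  baryP : exists s : {fset V}, [/\ K s,
    (forall v, v \in s -> 0 < bary v),
    (forall v, v \notin s -> bary v = 0)
    & \sum_(v <- s) bary v = 1]
}.

Section Topology.
Context {R : realType} {V : choiceType} {K : complex V}.
Local Notation rK := (realization R K).

HB.instance Definition _ := gen_eqMixin rK.
HB.instance Definition _ := gen_choiceMixin rK.

Definition closed_simplex (s : {fset V}) : set rK :=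
  [set x | forall v, v \notin s -> x v = 0].

(* The weak (coherent) topology: [U] is open iff its trace on every closed
   simplex is open for the Euclidean topology of that simplex, which is
   described by the sup distance between barycentric coordinates. *)
Definition realization_open (U : set rK) := forall s, K s ->
  forall x, U x -> closed_simplex s x -> exists2 e : R, 0 < e &
  forall y, closed_simplex s y -> (forall v, `|x v - y v| < e) -> U y.

Lemma realization_openT : realization_open setT.
Proof. by move=> s _ x _ _; exists 1. Qed.

Lemma realization_openI : setI_closed realization_open.
Proof.
move=> U U' oU oU' s Ks x [Ux U'x] sx.
have [e e0 He] := oU s Ks x Ux sx; have [e' e'0 He'] := oU' s Ks x U'x sx.
exists (Num.min e e'); first by rewrite lt_min e0.
move=> y sy xy; split; [apply: He => // v|apply: He' => // v].
  by have := xy v; rewrite lt_min => /andP[].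
by have := xy v; rewrite lt_min => /andP[].
Qed.

Lemma realization_open_bigU (I : Type) (f : I -> set rK) :
  (forall i, realization_open (f i)) -> realization_open (\bigcup_i f i).
Proof.
move=> of_ s Ks x [i _ fix_] sx; have [e e0 He] := of_ i s Ks x fix_ sx.
by exists e => // y sy xy; exists i => //; exact: He.
Qed.

HB.instance Definition _ := @isOpenTopological.Build rK realization_open
  realization_openT realization_openI realization_open_bigU.

End Topology.

Definition contractible (R : realType) (X : topologicalType) : Prop :=
  exists (x0 : X) (h : X * R -> X),
    [/\ {within [set: X] `*` `[0, 1], continuous h},
        (forall x, h (x, 0) = x)
      & (forall x, h (x, 1) = x0)].

(** * Subspaces endowed with a simplicial structure *)

(* A subspace of [X] (the image of [chart]) together with a simplicial
   structure whose vertices are points of [X]. Its simplices need not be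
   related to those of any simplicial structure that [X] may itself have. *)
Record simplicial_subspace (R : realType) (X : topologicalType) :=
  SimplicialSubspace {
  triangulation :> complex X;
  chart : realization R triangulation -> X;
  chart_inj : injective chart;
  chart_continuous : continuous chart;
  chart_embedding : forall U, open U ->
    exists2 O, open O & U = chart @^-1` O;
  chart_vertex : forall (x : realization R triangulation) (v : X),
    x v = 1 -> chart x = v
}.

Section SimplicialSubspaces.
Context {R : realType} {X : topologicalType}.
Implicit Types (T : simplicial_subspace R X) (K : complex X).

Definition underlying T : set X := range (@chart R X T).

Definition cell T (s : {fset X}) : set X := @chart R X T @` closed_simplex s.

(* A simplex of a simplicial subspace is both a vertex set and a subset of
   [X]: for [K], [K'] subcomplexes of [T], [T'], both have to match for a
   simplex of [K] to be a simplex of [K']. *)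
Definition subcomplex T T' K K' :=
  forall s, K s -> K' s /\ cell T s = cell T' s.

End SimplicialSubspaces.

(** * Quotient modules *)

Section QuotientModule.
Context {A : pzRingType} {M : lmodType A} (N : submodClosed M).

(* Over a ring, closure under scaling gives closure under opposite; the library
   does not infer it. *)
Definition submod_pred : {pred M} := N.

Lemma submod_pred_zmod : zmod_closed submod_pred.
Proof.
split=> [|x y xN yN]; first exact: rpred0.
by apply: rpredD => //; rewrite -scaleN1r; exact: rpredZ.
Qed.

HB.instance Definition _ := GRing.isZmodClosed.Build M submod_pred
  submod_pred_zmod.

Local Notation Q := {ideal_quot submod_pred}.

Definition quot_lmod := Q.

HB.instance Definition _ := GRing.Zmodule.on quot_lmod.

Definition quot_scale (a : A) (x : quot_lmod) : quot_lmod :=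
  \pi_(Q)%qT (a *: repr (x : Q)).

Lemma quot_scale_pi a x : quot_scale a (\pi_(Q)%qT x) = \pi_(Q)%qT (a *: x).
Proof.
apply/eqP; rewrite /quot_scale -ring_quotient.Quotient.idealrBE -scalerBr.
apply: (@rpredZ _ _ N); rewrite -[_ \in N]/(_ \in submod_pred).
by rewrite ring_quotient.Quotient.idealrBE reprK.
Qed.

Lemma quot_scaleA a b x : quot_scale a (quot_scale b x) = quot_scale (a * b) x.
Proof. by rewrite [quot_scale b x]/quot_scale quot_scale_pi scalerA. Qed.

Lemma quot_scale1 : left_id 1 quot_scale.
Proof. by move=> x; rewrite /quot_scale scale1r reprK. Qed.

Lemma quot_scaleDr : right_distributive quot_scale +%R.
Proof.
move=> a x y; rewrite -[x](@reprK _ Q) -[y](@reprK _ Q).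
rewrite -[LHS]/(quot_scale a (_ + _ : Q)) -raddfD !quot_scale_pi.
by rewrite scalerDr raddfD.
Qed.

Lemma quot_scaleDl x : {morph quot_scale^~ x : a b / a + b}.
Proof. by move=> a b; rewrite /quot_scale scalerDl raddfD. Qed.

HB.instance Definition _ := GRing.Zmodule_isLmodule.Build A quot_lmod
  quot_scaleA quot_scale1 quot_scaleDr quot_scaleDl.

End QuotientModule.

(** * Simplicial homology *)

Section Chains.
Context (A : pzRingType) {V : choiceType}.
Implicit Types (K L : complex V).

(* An oriented [n]-chain, as a function on ordered [n]-simplices: it has finite
   support, vanishes outside of [K] and on degenerate tuples, and reordering the
   vertices multiplies its value by the sign of the permutation. *)
Definition chain K n (c : n.+1.-tuple V -> A^o) : Prop :=
  [/\ finite_set [set t | c t != 0],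
      (forall t, c t != 0 -> uniq t /\ K [fset v in tval t]%fset)
    & (forall (t : n.+1.-tuple V) (s : 'S_n.+1),
        c [tuple tnth t (s i) | i < n.+1] = (-1) ^+ s * c t)].

(* The coefficient of the boundary of [c] on [v_0, ..., v_n] is the sum over
   all [v] of the coefficient of [c] on [v, v_0, ..., v_n]; see [boundary_elem]
   for the alternating sum formula. *)
Definition boundary n (c : n.+2.-tuple V -> A^o) : n.+1.-tuple V -> A^o :=
  fun t => \sum_(v \in [set: V]) c [tuple of v :: t].

(* The oriented simplex [t], as a chain. *)
Definition elem n (t : n.+1.-tuple V) : n.+1.-tuple V -> A^o :=
  fun u => \sum_(s : 'S_n.+1 | u == [tuple tnth t (s i) | i < n.+1]) (-1) ^+ s.

Lemma boundary_elem n (t : n.+2.-tuple V) : boundary (elem t) =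
  \sum_(i < n.+2) (-1) ^+ i *: elem [tuple tnth t (lift i j) | j < n.+1].
Proof.
apply/funext => u; rewrite /boundary /elem.
pose tu (s : 'S_n.+2) := [tuple tnth t (s i) | i < n.+2].
rewrite (fsbigTE [fset v in tval t]%fset) => [|v vt]; last first.
  rewrite big1// => s /eqP/(congr1 (fun w => tnth w ord0)).
  rewrite tnth_mktuple tnth0 => vE; move: vt.
  by rewrite inE /= vE mem_tnth.
have -> : (\sum_(i < n.+2) (-1) ^+ i *: elem [tuple tnth t (lift i j) | j < n.+1])
    u = \sum_(i < n.+2)
    (-1) ^+ i * elem [tuple tnth t (lift i j) | j < n.+1] u.
  exact: (big_morph (fun f : n.+1.-tuple V -> A^o => f u)).
under eq_bigr do rewrite big_mkcond.
rewrite exchange_big /= (partition_big (fun s : 'S_n.+2 => s ord0) xpredT)//=.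
apply: eq_bigr => i _.
rewrite (reindex (lift_perm ord0 i)) /=; last first.
  pose ulsf i (s : 'S_n.+2) k := odflt k (unlift (s i) (s (lift i k))).
  have ulsfK j (s : 'S_n.+2) k : lift (s j) (ulsf j s k) = s (lift j k).
    rewrite /ulsf; have := neq_lift j k.
    by rewrite -(can_eq (permK s)) => /unlift_some[] ? ? ->.
  have inj_ulsf : injective (ulsf ord0 _).
    move=> s; apply: can_inj (ulsf (s ord0) s^-1%g) _ => k'.
    by rewrite {1}/ulsf ulsfK !permK liftK.
  exists (fun s => perm (inj_ulsf s)) => [s _ | s].
    by apply/permP=> k'; rewrite permE /ulsf lift_perm_lift lift_perm_id liftK.
  rewrite inE => /eqP si0; apply/permP=> k.
  case: (unliftP ord0 k) => [k'|] ->; rewrite ?lift_perm_id //.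
  by rewrite lift_perm_lift -si0 permE ulsfK.
rewrite /elem [X in _ * X]big_mkcond mulr_sumr.
apply: eq_big => [s|s _]; first by rewrite lift_perm_id eqxx.
have tuE (v : V) : ([tuple of v :: u] == tu (lift_perm ord0 i s)) =
    (v == tnth t i) &&
    (u == [tuple tnth [tuple tnth t (lift i j) | j < n.+1] (s j) | j < n.+1]).
  apply/eqP/andP => [E|[/eqP-> /eqP->]].
    split; apply/eqP.
      have := congr1 (fun w => tnth w ord0) E.
      by rewrite tnth_mktuple tnth0 lift_perm_id.
    apply: eq_from_tnth => j; have := congr1 (fun w => tnth w (lift ord0 j)) E.
    by rewrite !tnth_mktuple tnthS lift_perm_lift.
  apply: eq_from_tnth => j; case: (unliftP ord0 j) => [k|] ->.
    by rewrite tnthS !tnth_mktuple lift_perm_lift.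
  by rewrite tnth0 tnth_mktuple lift_perm_id.
under eq_bigr do rewrite tuE.
rewrite (bigD1_seq (tnth t i)) ?fset_uniq//=; last by rewrite inE mem_tnth.
rewrite big1 ?addr0 => [|v /negPf->//]; rewrite eqxx/=; case: ifP => _.
  by rewrite odd_lift_perm /= signr_addb signr_odd.
by rewrite mulr0.
Qed.

Definition cycle K n (c : n.+1.-tuple V -> A^o) : Prop :=
  chain K c /\
  match n return (n.+1.-tuple V -> A^o) -> Prop with
  | 0 => fun=> True
  | m.+1 => fun c => boundary c = 0
  end c.

Definition is_boundary K n (c : n.+1.-tuple V -> A^o) : Prop :=
  exists2 b : n.+2.-tuple V -> A^o, chain K b & boundary b = c.

Definition cycles K n : {pred n.+1.-tuple V -> A^o} := [pred c | `[< cycle K c >]].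

Lemma chain_submod K n (a : A) (b c : n.+1.-tuple V -> A^o) :
  chain K b -> chain K c -> chain K (a *: b + c).
Proof.
move=> [finb suppb altb] [finc suppc altc]; split.
- apply: (@sub_finite_set _ _ ([set t | b t != 0] `|` [set t | c t != 0])).
    move=> t /=; rewrite -[(a *: b + c) t]/(a * b t + c t) => abc0.
    have [bt0|] := eqVneq (b t) 0; last by left.
    by right; move: abc0; rewrite bt0 mulr0 add0r.
  by rewrite finite_setU.
- move=> t; rewrite -[(a *: b + c) t]/(a * b t + c t) => abc0.
  have [bt0|/suppb//] := eqVneq (b t) 0.
  by apply: suppc; move: abc0; rewrite bt0 mulr0 add0r.
- move=> t s; rewrite -![(a *: b + c) _]/(a * b _ + c _) altb altc.
  by rewrite mulrDr !mulrA (commr_sign a s).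
Qed.

Lemma chain0 K n : chain K (0 : n.+1.-tuple V -> A^o).
Proof.
split=> [|t|t s]; rewrite ?mulr0 ?eqxx//.
by apply: (sub_finite_set _ (finite_set0 _)) => t /=; rewrite eqxx.
Qed.

Lemma finite_cons n (c : n.+2.-tuple V -> A^o) (t : n.+1.-tuple V) :
  finite_set [set u | c u != 0] ->
  finite_set [set v | c [tuple of v :: t] != 0].
Proof.
move=> finc; apply: (sub_finite_set _ (finite_image (@thead _ _) finc)).
by move=> v /= cvt; exists [tuple of v :: t].
Qed.

Lemma boundary_linear K n (a : A) (b c : n.+2.-tuple V -> A^o) :
  chain K b -> chain K c ->
  boundary (a *: b + c) = a *: boundary b + boundary c.
Proof.
move=> [finb _ _] [finc _ _]; apply/funext => t.
have fb := finite_cons t finb; have fc := finite_cons t finc.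
pose X := fset_set ([set v | b [tuple of v :: t] != 0] `|`
                    [set v | c [tuple of v :: t] != 0]).
have inX v : v \notin X -> b [tuple of v :: t] = 0 /\ c [tuple of v :: t] = 0.
  rewrite in_fset_set ?finite_setU// => /negP; rewrite inE /= => /not_orP[].
  by move=> /negP/negPn/eqP -> /negP/negPn/eqP ->.
rewrite -[RHS]/(a * boundary b t + boundary c t) /boundary.
rewrite !(fsbigTE X) => [|v /inX[]//|v /inX[]//|v /inX[b0 c0]].
  by rewrite mulr_sumr -big_split.
by rewrite -[LHS]/(a * b _ + c _) b0 c0 mulr0 addr0.
Qed.

Lemma boundary0 n : boundary (0 : n.+2.-tuple V -> A^o) = 0.
Proof. by apply/funext => t; rewrite /boundary fsbig1. Qed.

Lemma cyclesP K n c : reflect (@cycle K n c) (c \in @cycles K n).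
Proof. exact: asboolP. Qed.

Lemma cycles_submod K n : submod_closed (@cycles K n).
Proof.
split=> [|a b c].
  apply/cyclesP; split; first exact: chain0.
  by case: n => // n; exact: boundary0.
move=> /cyclesP[chb bb] /cyclesP[chc bc]; apply/cyclesP.
split; first exact: chain_submod.
case: n => // n in b c chb chc bb bc *.
by rewrite (boundary_linear _ chb chc) bb bc scaler0 addr0.
Qed.

HB.instance Definition _ K n :=
  GRing.isSubmodClosed.Build A (n.+1.-tuple V -> A^o) (@cycles K n)
    (cycles_submod K n).

Definition cycle_module K n := {c : n.+1.-tuple V -> A^o | c \in @cycles K n}.

HB.instance Definition _ K n := [isSub for @sval _ _ : cycle_module K n -> _].
HB.instance Definition _ K n := [Choice of cycle_module K n by <:].
HB.instance Definition _ K n :=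
  [SubChoice_isSubLmodule of cycle_module K n by <:].

Definition bounding K L n : {pred cycle_module K n} :=
  [pred z | `[< is_boundary L (val z) >]].

Lemma boundingP K L n z :
  reflect (is_boundary L (val z)) (z \in @bounding K L n).
Proof. exact: asboolP. Qed.

Lemma bounding_submod K L n : submod_closed (@bounding K L n).
Proof.
split=> [|a x y].
  by apply/boundingP; exists 0; [exact: chain0|rewrite boundary0 raddf0].
move=> /boundingP[b chb bx] /boundingP[c chc cy]; apply/boundingP.
exists (a *: b + c); first exact: chain_submod.
by rewrite (boundary_linear _ chb chc) bx cy linearP.
Qed.

HB.instance Definition _ K L n :=
  GRing.isSubmodClosed.Build A (cycle_module K n) (@bounding K L n)
    (bounding_submod K L n).

(* For [K] a subcomplex of [L], the [n]-cycles of [K] modulo those that are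
   boundaries in [L]. *)
Definition persistent_homology K L n : lmodType A :=
  quot_lmod (@bounding K L n).

End Chains.

(* Main.v *)
From HB Require Import structures.
Require Import Defs.
From mathcomp Require Import all_boot all_order all_algebra perm finmap.
From mathcomp Require Import all_classical all_reals all_analysis.
From mathcomp Require Import ring lra.
Import Order.TTheory GRing.Theory Num.Theory numFieldNormedType.Exports.

Set Implicit Arguments.
Unset Strict Implicit.
Unset Printing Implicit Defensive.

Local Open Scope classical_set_scope.
Local Open Scope ring_scope.


(** The simplicial chains of a cover and those of its nerve are the two edges of
    one double complex. Let [F] be a cover of [K] by subcomplexes; call a list
    [s] of vertices and a list [t] of indices incident when [s] spans a simplex
    of [F i] for every [i] of [t]. Incident pairs with [t] empty give the chains
    of [K], those with [s] empty give the chains of the nerve. For a fixed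
    nonempty [t], the row of [t] is the augmented chain complex of the
    intersection of the [F i], [i] in [t]: it is exact because this intersection
    is contractible ([incidence_row_acyclic], [row_exact]). For a fixed nonempty
    [s], the column of [s] is the augmented chain complex of the full simplex on
    all the [i] such that [F i] contains [s]; there is such an [i], and adding it
    in front of [t] contracts the column ([incidence_vertex], [column_exact]).
    By [filtration], a chain of the double complex whose boundary lies on one of
    the edges is, up to a boundary, on that edge. Hence a cycle of either edge is
    homologous, in the double complex, to a cycle of the other one
    ([row0_homologous], [column0_homologous]), and it bounds in the double
    complex only if it bounds in its own edge ([row0_boundary],
    [column0_boundary]).

    The double complex of [F l] is contained in that of [F (l + p)]. Match a
    cycle [z] of [D l] with a cycle [w] of [nerve (F l)] when [z - w] bounds in
    the double complex of [F (l + p)]. This correspondence is linear, it is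
    defined everywhere and onto by the results at level [l], and by the results
    at level [l + p] it relates boundaries only to boundaries: it induces an
    isomorphism of the persistent homology modules ([correspondence_iso],
    [persistent_nerve]).

    It remains to see that a complex [K] with a contractible realization has
    exact augmented chains ([contractible_acyclic]). A cycle [c] lives on
    finitely many closed simplices. Let [h] be the contraction. By compactness
    ([lebesgue]) there are [d > 0] and vertices [phi (a, x)] of [K] such that
    [h] maps the [d]-neighbourhood of [(x, a)] into the open star of
    [phi (a, x)]. So [phi (a, -)] sends the vertices of any [d]-small set of
    points to those of a simplex of [K], and for [a], [b] less than [d] apart,
    [phi (a, -)] and [phi (b, -)] are contiguous, hence homotopic. The [d]-small
    lists of points of one closed simplex form an acyclic complex
    ([rips_acyclic]), so the method of acyclic carriers ([carrier]) gives a chain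
    map [sd] from the simplices of [c] to small lists, which plays the role of an
    iterated subdivision. As [h] starts at the identity, [phi (0, -)] chooses a
    vertex of the carrier of each point, and [phi (0, -)] after [sd] is homotopic
    to the identity, by acyclic carriers again. As [h] ends at a point,
    [phi (1, -)] takes its values in one simplex. Hence [c] bounds.

    All this is done with chains on lists of vertices, repetitions allowed: for
    these, cones, simplicial maps and prisms are given by formulas without
    choices. They are related to alternating chains by [orient], a chain map with
    a section given by the lists that increase for some total order on the
    vertices ([orient_increasing_part], [bd_increasing_part]); acyclic carriers
    show that the section is also an inverse in homology
    ([straighten_homotopy]). *)

(** * Free modules *)

Section FreeModule.
Context (A : pzRingType) (T : choiceType).

Definition finsupp_fun : {pred T -> A^o} :=
  [pred c | `[< finite_set [set t | c t != 0] >]].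

Lemma finsupp_submod : submod_closed finsupp_fun.
Proof.
split=> [|a b c /asboolP finb /asboolP finc]; apply/asboolP.
  by apply: (sub_finite_set _ (finite_set0 _)) => t /=; rewrite eqxx.
apply: (@sub_finite_set _ _ ([set t | b t != 0] `|` [set t | c t != 0])).
  move=> t /=; rewrite -[(a *: b + c) t]/(a * b t + c t) => abc0.
  have [bt0|] := eqVneq (b t) 0; last by left.
  by right; move: abc0; rewrite bt0 mulr0 add0r.
by rewrite finite_setU.
Qed.

HB.instance Definition _ :=
  GRing.isSubmodClosed.Build A (T -> A^o) finsupp_fun finsupp_submod.

Definition free := {c : T -> A^o | c \in finsupp_fun}.

HB.instance Definition _ := [isSub for @sval _ _ : free -> _].
HB.instance Definition _ := [Choice of free by <:].
HB.instance Definition _ := [SubChoice_isSubLmodule of free by <:].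

Definition coef (c : free) : T -> A := val c.

Lemma coefD c d t : coef (c + d) t = coef c t + coef d t.
Proof. by []. Qed.
Lemma coefN c t : coef (- c) t = - coef c t.
Proof. by []. Qed.
Lemma coefZ a c t : coef (a *: c) t = a * coef c t.
Proof. by []. Qed.
Lemma coef0 t : coef 0 t = 0.
Proof. by []. Qed.

Lemma freeP c d : coef c =1 coef d -> c = d.
Proof. by move=> /funext cd; apply: val_inj. Qed.

Lemma coef_sum (I : Type) (r : seq I) (P : pred I) (F : I -> free) t :
  coef (\sum_(i <- r | P i) F i) t = \sum_(i <- r | P i) coef (F i) t.
Proof. by apply: (big_morph (coef^~ t)). Qed.

Definition supp (c : free) : {fset T} := fset_set [set t | coef c t != 0].

Lemma mem_supp c t : (t \in supp c) = (coef c t != 0).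
Proof.
have /asboolP fin := valP c.
rewrite in_fset_set //; apply/idP/idP => [|ct]; first by rewrite inE.
by rewrite inE.
Qed.

Lemma delta_subproof (t : T) : (fun u => (u == t)%:R : A^o) \in finsupp_fun.
Proof.
apply/asboolP/(sub_finite_set _ (finite_set1 t)) => u /=.
by case: (eqVneq u t) => // _; rewrite eqxx.
Qed.

Definition delta (t : T) : free :=
  @exist _ (fun c : T -> A^o => c \in finsupp_fun) _ (delta_subproof t).

Lemma coef_delta t u : coef (delta t) u = (u == t)%:R.
Proof. by []. Qed.

(** The larger index set [S] lets several chains be expanded over a common set. *)
Lemma free_sum (c : free) (S : {fset T}) : (supp c `<=` S)%fset ->
  c = \sum_(t <- S) coef c t *: delta t.
Proof.
move=> cS; apply: freeP => u; rewrite coef_sum.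
under eq_bigr do rewrite coefZ coef_delta.
have [uS|uS] := boolP (u \in S).
  rewrite (bigD1_seq u) ?fset_uniq //= eqxx mulr1 big1 ?addr0 // => t tu.
  by rewrite eq_sym (negPf tu) mulr0.
rewrite big1_seq => [|t /andP[_ tS]]; last first.
  by case: eqP tS uS => [->|_ _ _]; rewrite ?mulr0 // => ->.
apply/eqP; apply: contraNT uS; rewrite -mem_supp; exact: fsubsetP.
Qed.

Definition carried (P : set T) (c : free) := forall t, coef c t != 0 -> P t.

Lemma carried0 P : carried P 0.
Proof. by move=> t; rewrite coef0 eqxx. Qed.

Lemma carriedZ P a c : carried P c -> carried P (a *: c).
Proof.
move=> Pc t; rewrite coefZ; have [->|/Pc//] := eqVneq (coef c t) 0.
by rewrite mulr0 eqxx.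
Qed.

Lemma carriedD P c d : carried P c -> carried P d -> carried P (c + d).
Proof.
move=> Pc Pd t; rewrite coefD; have [->|/Pc//] := eqVneq (coef c t) 0.
by rewrite add0r; exact: Pd.
Qed.

Lemma carriedN P c : carried P c -> carried P (- c).
Proof. by rewrite -scaleN1r; exact: carriedZ. Qed.

Lemma carriedB P c d : carried P c -> carried P d -> carried P (c - d).
Proof. by move=> Pc Pd; apply: carriedD => //; exact: carriedN. Qed.

Lemma carried_sum P (I : eqType) (r : seq I) (F : I -> free) :
  (forall i, i \in r -> carried P (F i)) -> carried P (\sum_(i <- r) F i).
Proof.
move=> PF; rewrite big_seq; apply: (big_ind (carried P)) => //.
  exact: carried0.
exact: carriedD.
Qed.

Lemma carried_delta (P : set T) t : P t -> carried P (delta t).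
Proof.
move=> Pt u; rewrite coef_delta; have [->//|_] := eqVneq u t.
by rewrite eqxx.
Qed.

Lemma carriedW (P Q : set T) c : carried P c -> P `<=` Q -> carried Q c.
Proof. by move=> Pc PQ t /Pc; exact: PQ. Qed.

Lemma carried_ind (P : set T) (Q : free -> Prop) : Q 0 ->
  (forall a t c, P t -> Q c -> Q (a *: delta t + c)) ->
  forall c, carried P c -> Q c.
Proof.
move=> Q0 QD c Pc; rewrite (free_sum (fsubset_refl (supp c))) big_seq.
apply: (big_rec Q) => // t d; rewrite mem_supp => /Pc Pt.
exact: QD.
Qed.

Lemma eq_lin (M : lmodType A) (P : set T) (f g : {linear free -> M}) :
  (forall t, P t -> f (delta t) = g (delta t)) ->
  forall c, carried P c -> f c = g c.
Proof.
move=> fg; apply: carried_ind => [|a t c Pt fgc]; first by rewrite !linear0.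
by rewrite !linearP fg // fgc.
Qed.

Lemma free_ind (Q : free -> Prop) : Q 0 ->
  (forall a t c, Q c -> Q (a *: delta t + c)) -> forall c, Q c.
Proof.
by move=> Q0 QD c; apply: (@carried_ind setT) => // a t d _; exact: QD.
Qed.

Section Ext.
Context (M : lmodType A) (f : T -> M).

Definition ext (c : free) : M := \sum_(t <- supp c) coef c t *: f t.

Lemma ext_sub c (S : {fset T}) : (supp c `<=` S)%fset ->
  ext c = \sum_(t <- S) coef c t *: f t.
Proof.
move=> cS; rewrite /ext (big_fset_incl _ cS) // => t _.
by rewrite mem_supp negbK => /eqP ->; rewrite scale0r.
Qed.

Lemma ext_is_linear : linear ext.
Proof.
move=> a c d; pose S := (supp c `|` supp d `|` supp (a *: c + d)%R)%fset.
rewrite !(@ext_sub _ S) /S ?fsubsetUr //; first last.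
- by rewrite -fsetUA fsubsetUl.
- by rewrite fsetUAC fsubsetUr.
rewrite scaler_sumr -big_split /=; apply: eq_bigr => t _.
by rewrite coefD coefZ scalerDl scalerA.
Qed.

HB.instance Definition _ :=
  GRing.isLinear.Build A free M *:%R ext ext_is_linear.

Lemma ext_delta t : ext (delta t) = f t.
Proof.
rewrite (@ext_sub _ [fset t]%fset) ?big_seq_fset1 ?coef_delta ?eqxx ?scale1r //.
apply/fsubsetP => u; rewrite mem_supp coef_delta inE.
by case: (u == t) => //; rewrite eqxx.
Qed.

End Ext.

End FreeModule.
Arguments ext {A T M} f.

Section Within.
Context (A : pzRingType) (T U : choiceType).

Lemma carried_lin (P : set T) (Q : set U) (f : {linear free A T -> free A U}) :
  (forall t, P t -> carried Q (f (delta A t))) ->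
  forall c, carried P c -> carried Q (f c).
Proof.
move=> fQ; apply: carried_ind => [|a t c Pt fc]; first by rewrite linear0; exact: carried0.
by rewrite linearP; apply: carriedD => //; apply: carriedZ; exact: fQ.
Qed.

End Within.

(** * Ordered chains *)

Section Ordered.
Context (A : pzRingType) (V : choiceType).
Local Notation chain := (free A (seq V)).
Local Notation delta := (@delta A (seq V)).

Definition cone (v : V) : chain -> chain := ext (fun t => delta (v :: t)).

HB.instance Definition _ v := GRing.Linear.on (cone v).

Lemma cone_delta v t : cone v (delta t) = delta (v :: t).
Proof. exact: ext_delta. Qed.

(** The boundary is augmented, the boundary of a point being the empty list; the
    recursion says that [cone v] is a contraction up to the face opposite to
    [v], which makes [bd_bd] and all cone arguments immediate. *)
Fixpoint bd_simplex (t : seq V) : chain :=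
  if t is v :: u then delta u - cone v (bd_simplex u) else 0.

Definition bd : chain -> chain := ext bd_simplex.

HB.instance Definition _ := GRing.Linear.on bd.

Lemma bd_nil : bd (delta [::]) = 0.
Proof. exact: ext_delta. Qed.

Lemma bd_cons v t : bd (delta (v :: t)) = delta t - cone v (bd (delta t)).
Proof. by rewrite /bd /= !ext_delta. Qed.

Lemma bd_cone v c : bd (cone v c) = c - cone v (bd c).
Proof.
elim/free_ind: c => [|a t c IH].
  by rewrite !linear0 addr0.
by rewrite !linearP /= IH cone_delta bd_cons scalerBr addrACA scalerN.
Qed.

Lemma bd_bd c : bd (bd c) = 0.
Proof.
elim/free_ind: c => [|a t c IH]; first by rewrite !linear0.
rewrite !linearP /= IH addr0; suff -> : bd (bd (delta t)) = 0 by rewrite scaler0.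
elim: t => [|v t IHt]; first by rewrite bd_nil linear0.
by rewrite bd_cons linearB /= bd_cone IHt linear0 subr0 subrr.
Qed.

Lemma bd_face t :
  carried [set u | subseq u t /\ (size u).+1 = size t] (bd (delta t)).
Proof.
elim: t => [|v t IH]; first by rewrite bd_nil; exact: carried0.
rewrite bd_cons; apply: carriedB.
  by apply: carried_delta; split=> //; exact: subseq_cons.
apply: carried_lin IH => u [ut su] /=; rewrite cone_delta; apply: carried_delta.
by split; rewrite /= ?eqxx ?su.
Qed.

Definition face_closed (K : set (seq V)) :=
  forall t u, K t -> subseq u t -> K u.

(** Exactness in all degrees at once, the empty list included: for the lists of
    simplices of a complex this is the vanishing of reduced homology. *)
Definition acyclic (K : set (seq V)) :=
  forall c, carried K c -> bd c = 0 -> exists2 d, carried K d & bd d = c.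

Lemma cone_acyclic K v : (forall t, K t -> K (v :: t)) -> acyclic K.
Proof.
move=> Kv c Kc c0; exists (cone v c); last by rewrite bd_cone c0 linear0 subr0.
apply: carried_lin Kc => t Kt /=; rewrite cone_delta; apply: carried_delta.
exact: Kv.
Qed.

End Ordered.
Arguments bd {A V}.
Arguments cone {A V}.

Section Push.
Context (A : pzRingType) (V W : choiceType).

Definition push (f : V -> W) : free A (seq V) -> free A (seq W) :=
  ext (fun t => delta A (map f t)).

HB.instance Definition _ f := GRing.Linear.on (push f).

Lemma push_delta f t : push f (delta A t) = delta A (map f t).
Proof. exact: ext_delta. Qed.

Lemma push_cone f v c : push f (cone v c) = cone (f v) (push f c).
Proof.
elim/free_ind: c => [|a t c IH]; first by rewrite !linear0.
by rewrite !linearP /= IH cone_delta !push_delta cone_delta.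
Qed.

Lemma bd_push f c : bd (push f c) = push f (bd c).
Proof.
elim/free_ind: c => [|a t c IH]; first by rewrite !linear0.
rewrite !linearP /= IH; congr (_ *: _ + _).
elim: t => [|v t IHt]; first by rewrite push_delta !bd_nil linear0.
by rewrite push_delta !bd_cons -push_delta IHt linearB /= push_cone.
Qed.

Section Prism.
Context (f g : V -> W).

(** The recursive form of the alternating sum of the
    [f v_0, ..., f v_i, g v_i, ..., g v_n]. *)
Fixpoint prism_simplex (t : seq V) : free A (seq W) :=
  if t is v :: u then
    delta A (f v :: g v :: map g u) - cone (f v) (prism_simplex u)
  else 0.

Definition prism : free A (seq V) -> free A (seq W) := ext prism_simplex.

HB.instance Definition _ := GRing.Linear.on prism.

Lemma prism_cons v t : prism (delta A (v :: t)) =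
  cone (f v) (cone (g v) (push g (delta A t)))
  - cone (f v) (prism (delta A t)).
Proof. by rewrite /prism /= !ext_delta push_delta !cone_delta. Qed.

Lemma prism_cone v c : prism (cone v c) =
  cone (f v) (cone (g v) (push g c)) - cone (f v) (prism c).
Proof.
elim/free_ind: c => [|a t c IH].
  by rewrite !linear0 addr0.
by rewrite !linearP /= IH cone_delta prism_cons scalerBr addrACA scalerN.
Qed.

Lemma bd_prism c : bd (prism c) = push g c - push f c - prism (bd c).
Proof.
elim/free_ind: c => [|a t c IH].
  by rewrite !linear0 !addr0.
rewrite !linearP /= IH [a *: push g _ + _ + _]addrACA -scalerDr.
rewrite [RHS]addrACA -scalerDr; congr (_ *: _ + _).
elim: t => [|v t IHt].
  by rewrite bd_nil linear0 !push_delta subrr [prism _]ext_delta !linear0 addr0.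
rewrite prism_cons linearB /= !bd_cone IHt bd_push bd_cons.
rewrite -!cone_delta !push_cone !(linearB, prism_cone) /= prism_cone.
rewrite !opprD !opprK !addrA [LHS](ACl (1*6*4*3*7*(5*2))) /=.
by rewrite subrr addr0.
Qed.

Lemma carried_prism t :
  carried [set u : seq W | {subset u <= map f t ++ map g t}] (prism (delta A t)).
Proof.
elim: t => [|v t IH]; first by rewrite [prism _]ext_delta; exact: carried0.
rewrite prism_cons push_delta !cone_delta; apply: carriedB.
  apply: carried_delta => w; rewrite /= !(inE, mem_cat).
  by move=> /or3P[]->; rewrite ?orbT.
apply: carried_lin IH => u ut /=; rewrite cone_delta; apply: carried_delta => w.
rewrite /= inE => /predU1P[->|/ut]; first by rewrite inE eqxx.
by rewrite !(inE, mem_cat) => /orP[]->; rewrite ?orbT.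
Qed.

(** Contiguous simplicial maps are homotopic: the hypothesis says that the images
    of a simplex by [f] and by [g] span one simplex of [L]. *)
Lemma contiguous_homology (K : set (seq V)) (L : set (seq W)) c :
  (forall t u, K t -> {subset u <= map f t ++ map g t} -> L u) ->
  carried K c -> bd c = 0 ->
  exists2 d, carried L d & bd d = push g c - push f c.
Proof.
move=> KL Kc c0; exists (prism c); last by rewrite bd_prism c0 linear0 subr0.
apply: carried_lin Kc => t Kt /=; apply: (carriedW (carried_prism (t := t))) => u.
exact: KL.
Qed.

End Prism.

Lemma carried_push (f : V -> W) (K : set (seq V)) (L : set (seq W)) c :
  (forall t, K t -> L (map f t)) -> carried K c -> carried L (push f c).
Proof.
move=> KL; apply: carried_lin => t Kt /=; rewrite push_delta.
by apply: carried_delta; exact: KL.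
Qed.

End Push.

(** * Acyclic carriers *)

Section Carriers.
Context (A : pzRingType) (V W : choiceType).
Section Carrier.
Context (S : set (seq V)) (Phi : seq V -> set (seq W)).
Context (g : {linear free A (seq V) -> free A (seq W)}) (e : A).
Context (X0 : free A (seq W)).
Hypothesis eC : forall a, a * e = e * a.
Hypothesis faceS : face_closed S.
Hypothesis Phi_mono : forall t u, S t -> subseq u t -> Phi u `<=` Phi t.
Hypothesis Phi_acyclic : forall t, S t -> t != [::] -> acyclic A (Phi t).
Hypothesis X0_carried : carried (Phi [::]) X0.
Hypothesis bd_X0 : bd X0 = g (delta A [::]).
Hypothesis g_carried : forall t, S t -> carried (Phi t) (g (delta A t)).
Hypothesis bd_g : forall t, S t -> t != [::] ->
  bd (g (delta A t)) + e *: g (bd (delta A t)) = 0.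

(** The values on lists of length [n.+1] are chosen by acyclicity, once those on
    shorter lists are known: the chain to be filled is a cycle by [bd_g] and by
    the equations in lower degrees. *)
Lemma carrier_step n : exists X : seq V -> free A (seq W),
  X [::] = X0 /\ forall t, S t -> (size t <= n)%N ->
  carried (Phi t) (X t) /\ bd (X t) = g (delta A t) + e *: ext X (bd (delta A t)).
Proof.
elim: n => [|n [X [XX0 IH]]].
  exists (fun=> X0); split=> // t St; rewrite leqn0 => /nilP ->.
  by rewrite bd_nil linear0 scaler0 addr0; split.
have faceX t : S t -> (size t <= n.+1)%N ->
    carried [set u | S u /\ subseq u t /\ (size u <= n)%N] (bd (delta A t)).
  move=> St tn; apply: (carriedW (@bd_face A V t)) => u [ut su]; split.
    exact: faceS St ut.
  by split=> //; rewrite -ltnS su.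
have [Y YP] : exists Y : seq V -> free A (seq W), forall t, S t ->
    (size t <= n.+1)%N -> t != [::] -> carried (Phi t) (Y t) /\
    bd (Y t) = g (delta A t) + e *: ext X (bd (delta A t)).
  suff /choice[Y YP] : forall t, exists y, S t ->
      (size t <= n.+1)%N -> t != [::] -> carried (Phi t) y /\
      bd y = g (delta A t) + e *: ext X (bd (delta A t)) by exists Y.
  move=> t; have [[St tn t0]|nt] :=
    pselect [/\ S t, (size t <= n.+1)%N & t != [::]]; last first.
    by exists 0 => St tn t0; case: nt.
  have Xbd : bd (ext X (bd (delta A t))) =
      g (bd (delta A t)) + e *: ext X (bd (bd (delta A t))).
    move: (faceX t St tn); move: (bd (delta A t)).
    apply: carried_ind => [|a u d [Su [_ un]] IHd].
      by rewrite !linear0 scaler0 addr0.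
    have [_ bdXu] := IH u Su un.
    rewrite !linearP /= IHd ext_delta bdXu scalerDr addrACA.
    by rewrite scalerDr !scalerA eC.
  have [y Py ybd] : exists2 y, carried (Phi t) y &
      bd y = g (delta A t) + e *: ext X (bd (delta A t)).
    apply: Phi_acyclic => //.
      apply: carriedD; first exact: g_carried.
      apply: carriedZ; apply: carried_lin (faceX t St tn) => u [Su [ut un]].
      rewrite /= ext_delta; have [XuP _] := IH u Su un; apply: (carriedW XuP).
      exact: Phi_mono.
    by rewrite linearD linearZ /= Xbd bd_bd linear0 scaler0 addr0 bd_g.
  by exists y.
exists (fun t => if (size t <= n)%N then X t else Y t); split=> // t St tn.
have -> : ext (fun t => if (size t <= n)%N then X t else Y t)
    (bd (delta A t)) = ext X (bd (delta A t)).
  apply: eq_lin (faceX t St tn) => u [_ [_ un]] /=.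
  by rewrite !ext_delta un.
have [tn'|nt] := leqP (size t) n; first exact: IH.
by apply: YP => //; rewrite -size_eq0 -lt0n (leq_ltn_trans _ nt).
Qed.

(** The method of acyclic carriers. The coefficient [e] makes one statement out of
    the two standard ones: a chain map is obtained from [e = 1] and [g = 0], a
    homotopy from [g] to zero from [e = -1]. The lists of [S] are bounded in
    length, so that only finitely many choice steps are needed. *)
Lemma carrier n : (forall t, S t -> (size t <= n)%N) ->
  exists X : {linear free A (seq V) -> free A (seq W)},
  [/\ X (delta A [::]) = X0,
      forall t, S t -> carried (Phi t) (X (delta A t)) &
      forall c, carried S c -> bd (X c) = g c + e *: X (bd c)].
Proof.
move=> Sn; have [X [XX0 XP]] := carrier_step n; exists (ext X); split.
- by rewrite /= ext_delta.
- by move=> t St; rewrite /= ext_delta; have [] := XP t St (Sn t St).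
apply: carried_ind => [|a t c St IH]; first by rewrite !linear0 scaler0 addr0.
have [_ bdX] := XP t St (Sn t St).
rewrite !linearP /= IH ext_delta bdX scalerDr addrACA.
by rewrite scalerDr !scalerA eC.
Qed.

End Carrier.
Lemma acyclic_chain_map (S : set (seq V)) (Phi : seq V -> set (seq W)) n :
  face_closed S -> (forall t, S t -> (size t <= n)%N) ->
  (forall t u, S t -> subseq u t -> Phi u `<=` Phi t) ->
  (forall t, S t -> t != [::] -> acyclic A (Phi t)) ->
  Phi [::] [::] ->
  exists X : {linear free A (seq V) -> free A (seq W)},
  [/\ X (delta A [::]) = delta A [::],
      forall t, S t -> carried (Phi t) (X (delta A t)) &
      forall c, carried S c -> bd (X c) = X (bd c)].
Proof.
move=> faceS Sn Phi_mono Phi_ac Phi0.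
pose z : {linear free A (seq V) -> free A (seq W)} := \0.
have eC (a : A) : a * 1 = 1 * a by rewrite mul1r mulr1.
have X0_carried : carried (Phi [::]) (delta A [::]) by exact: carried_delta.
have bd0 : bd (delta A [::]) = z (delta A [::]) by rewrite bd_nil.
have z_carried t : S t -> carried (Phi t) (z (delta A t)).
  by move=> _; exact: carried0.
have bd_z t : S t -> t != [::] ->
    bd (z (delta A t)) + 1 *: z (bd (delta A t)) = 0.
  by rewrite linear0 scaler0 addr0.
have [X [X0 XP bdX]] := @carrier S Phi z 1 (delta A [::]) eC faceS Phi_mono
  Phi_ac X0_carried bd0 z_carried bd_z n Sn.
by exists X; split=> // c Sc; rewrite bdX // add0r scale1r.
Qed.

End Carriers.

Section Homotopy.
Context (A : pzRingType) (V : choiceType).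

Lemma simplex_acyclic (t : seq V) : t != [::] ->
  acyclic A [set u : seq V | {subset u <= t}].
Proof.
case: t => // v t _; apply: (@cone_acyclic _ _ _ v) => u ut w.
by rewrite inE => /predU1P[->|/ut//]; rewrite inE eqxx.
Qed.

(** A chain map that carries each list to lists with entries in it is homotopic to
    the identity, because a full simplex is acyclic. The boundary of [c] may be
    nonzero on the empty list so that [c] can be an unreduced cycle of degree
    zero; the homotopy vanishes on the empty list. *)
Lemma carried_by_simplices (K L : set (seq V))
  (f : {linear free A (seq V) -> free A (seq V)}) c :
  face_closed K -> (forall t u, K t -> {subset u <= t} -> L u) ->
  (forall t, K t -> carried [set u : seq V | {subset u <= t}] (f (delta A t))) ->
  (forall t, K t -> t != [::] -> bd (f (delta A t)) = f (bd (delta A t))) ->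
  f (delta A [::]) = delta A [::] ->
  carried K c -> carried [set [::]] (bd c) ->
  exists2 d, carried L d & bd d = c - f c.
Proof.
move=> faceK KL fK bdf f0 Kc c0.
pose n := (\max_(t <- supp c) size t)%N.
pose S t := K t /\ (size t <= n)%N.
pose Phi (t : seq V) := [set u : seq V | {subset u <= t}].
pose g : {linear free A (seq V) -> free A (seq V)} := idfun \- f.
have eC (a : A) : a * -1 = -1 * a by rewrite mulrN1 mulN1r.
have faceS : face_closed S.
  move=> t u [Kt tn] ut; split; first exact: faceK Kt ut.
  exact: leq_trans (size_subseq ut) tn.
have Phi_mono t u : S t -> subseq u t -> Phi u `<=` Phi t.
  by move=> _ ut w wu x /wu; exact: (mem_subseq ut).
have Phi_ac t : S t -> t != [::] -> acyclic A (Phi t).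
  by move=> _; exact: simplex_acyclic.
have X0_carried : carried (Phi [::]) (0 : free A (seq V)) by exact: carried0.
have bd0 : bd 0 = g (delta A [::]) by rewrite linear0 /= f0 subrr.
have g_carried t : S t -> carried (Phi t) (g (delta A t)).
  move=> [Kt _]; apply: carriedB; first exact: carried_delta.
  exact: fK.
have bd_g t : S t -> t != [::] ->
    bd (g (delta A t)) + -1 *: g (bd (delta A t)) = 0.
  by move=> [Kt _] t0; rewrite linearB /= bdf // scaleN1r subrr.
have Sn t : S t -> (size t <= n)%N by case.
have [X [X0 XP bdX]] := @carrier A V V S Phi g (-1) 0 eC faceS Phi_mono
  Phi_ac X0_carried bd0 g_carried bd_g n Sn.
have Sc : carried S c.
  move=> t ct; split; first exact: Kc.
  by apply: (@leq_bigmax_seq _ _ xpredT size) => //; rewrite mem_supp.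
exists (X c).
  apply: carried_lin Sc => t [Kt tn]; apply: (carriedW (XP t _)) => // u ut.
  exact: KL Kt ut.
rewrite bdX //= scaleN1r; suff -> : X (bd c) = 0 by rewrite subr0.
pose z : {linear free A (seq V) -> free A (seq V)} := \0.
by rewrite (eq_lin (g := z) _ c0) // => t ->; rewrite X0.
Qed.

End Homotopy.

(** * Small simplices in a geometric simplex *)

(** Common smallness for finitely many conditions that persist when the positive
    bound [e] decreases. *)
Lemma uniform_eps (R : realType) (T : eqType) (l : seq T) (Q : T -> R -> Prop) :
  (forall t e e', Q t e -> 0 < e' <= e -> Q t e') ->
  (forall t, t \in l -> exists2 e, 0 < e & Q t e) ->
  exists2 e, 0 < e & forall t, t \in l -> Q t e.
Proof.
move=> Qle; elim: l => [|t l IH] lQ; first by exists 1.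
have [|e e0 le] := IH; first by move=> u ul; apply: lQ; rewrite inE ul orbT.
have [|e' e'0 te'] := lQ t; first by rewrite inE eqxx.
exists (Num.min e e') => [|u]; first by rewrite lt_min e0.
rewrite inE => /predU1P[->|ul].
  by apply: Qle te' _; rewrite lt_min e0 e'0 ge_min lexx orbT.
by apply: Qle (le _ ul) _; rewrite lt_min e0 e'0 ge_min lexx.
Qed.

Lemma fine_grid (R : realType) (e : R) : 0 < e ->
  exists2 m : nat, (0 < m)%N & forall j, `|j.+1%:R / m%:R - j%:R / m%:R| < e.
Proof.
move=> e0; pose m := (Num.trunc e^-1).+1; exists m => // j.
have m0 : 0 < m%:R :> R by rewrite ltr0n.
rewrite -mulrBl -natrB ?leqnSn // subSnn div1r ger0_norm ?invr_ge0 ?ltW //.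
by rewrite invf_plt // Num.Theory.truncnS_gt.
Qed.

Lemma homologous_path (A : pzRingType) (V : choiceType) (L : set (seq V))
    (h : nat -> free A (seq V)) m :
  (forall j, (j < m)%N -> exists2 d, carried L d & bd d = h j.+1 - h j) ->
  exists2 d, carried L d & bd d = h m - h 0%N.
Proof.
elim: m => [|m IH] hL.
  by exists 0; [exact: carried0|rewrite linear0 subrr].
have [j jm|d Ld dE] := IH; first by apply: hL; exact: ltnW.
have [//|d' Ld' d'E] := hL m; exists (d' + d); first exact: carriedD.
by rewrite linearD /= dE d'E addrA subrK.
Qed.

Section Rips.
Context (A : pzRingType) (R : realType) (V : choiceType).
Implicit Types (x y : V -> R) (s : {fset V}).

Definition in_simplex s x := [/\ forall v, 0 <= x v,
  forall v, v \notin s -> x v = 0 & \sum_(v <- s) x v = 1].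

Lemma in_simplexS s s' x : (s `<=` s')%fset -> in_simplex s x ->
  in_simplex s' x.
Proof.
move=> ss' [x0 xs x1]; split=> // [v vs'|].
  by apply: xs; apply: contra vs'; exact: (fsubsetP ss').
by rewrite -(big_fset_incl _ ss') // => v _; exact: xs.
Qed.

Lemma in_simplex_le1 s x v : in_simplex s x -> x v <= 1.
Proof.
move=> [x0 xs <-]; have [vs|/xs ->] := boolP (v \in s); last exact: sumr_ge0.
by rewrite (bigD1_seq v) ?fset_uniq //= lerDl sumr_ge0.
Qed.

(** The Vietoris-Rips complex of the geometric simplex on [s] at scale [d], for the
    sup distance between barycentric coordinates. *)
Definition rips s (d : R) : set (seq (V -> R)) :=
  [set q : seq (V -> R) | (forall x, x \in q -> in_simplex s x) /\
    forall x y v, x \in q -> y \in q -> `|x v - y v| < d].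

Definition segment (c : V -> R) (a : R) (x : V -> R) : V -> R :=
  fun v => (1 - a) * x v + a * c v.

Lemma in_simplex_segment s c a x : 0 <= a <= 1 -> in_simplex s c ->
  in_simplex s x -> in_simplex s (segment c a x).
Proof.
move=> /andP[a0 a1] [c0 cs c1] [x0 xs x1]; split=> [v|v vs|].
- by rewrite addr_ge0 ?mulr_ge0 // subr_ge0.
- by rewrite /segment cs // xs // !mulr0 addr0.
- by rewrite big_split /= -!mulr_sumr c1 x1 !mulr1 subrK.
Qed.

(** A chain is made of finitely many lists, so the strict bound [d] leaves some
    room. This is what allows to move the points a little in [rips_acyclic]. *)
Lemma rips_strict s d z : 0 < d -> carried (rips s d) z ->
  exists2 e : R, 0 < e & carried (rips s (d - e)) (z : free A (seq (V -> R))).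
Proof.
move=> d0 zd.
have [q e e' qe /andP[e'0 e'e]|q|e e0 eP] := @uniform_eps R _ (supp z)
    (fun q e => rips s (d - e) q).
- split=> [|x y v xq yq]; first by case: qe.
  by apply: lt_le_trans (qe.2 x y v xq yq) _; rewrite lerB.
- rewrite mem_supp => /zd[qs qd].
  have [xy e e' xye /andP[e'0 e'e]|[x y]
      /allpairsP[[x' y'] [/= x'q y'q [-> ->]]]|e e0 eP] :=
    @uniform_eps R _ [seq (x, y) | x <- q, y <- q]
      (fun xy e => forall v, `|xy.1 v - xy.2 v| < d - e).
  + by move=> v; apply: lt_le_trans (xye v) _; rewrite lerB.
  + have [v e e' ve /andP[e'0 e'e]|v vs|e e0 eP] := @uniform_eps R _ (enum_fset s)
      (fun v e => `|x' v - y' v| < d - e).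
    * by apply: lt_le_trans ve _; rewrite lerB.
    * exists ((d - `|x' v - y' v|) / 2).
        by rewrite divr_gt0 // subr_gt0 qd.
      by have := qd x' y' v x'q y'q; lra.
    * exists (Num.min e (d / 2)) => [|v]; first by rewrite lt_min e0 divr_gt0.
      have [vs|vs] := boolP (v \in s).
        apply: lt_le_trans (eP v vs) _.
        by rewrite lerB // ge_min lexx.
      have [_ x's _] := qs _ x'q; have [_ y's _] := qs _ y'q.
      rewrite x's // y's // subr0 normr0 subr_gt0.
      by rewrite gt_min orbC; apply/orP; left; lra.
  + exists e => //; split=> // x y v xq yq.
    by apply: (eP (x, y)); apply: allpairs_f.
- by exists e => // q zq; apply: eP; rewrite mem_supp.
Qed.

Lemma push_id (W : choiceType) (f : W -> W) (z : free A (seq W)) : f =1 id ->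
  push f z = z.
Proof.
move=> fid; pose g : {linear free A (seq W) -> free A (seq W)} := idfun.
apply: (@eq_lin _ _ _ setT _ g) => // t _.
by rewrite /= push_delta (eq_map fid) map_id.
Qed.

(** Contract the geometric simplex to a vertex along segments, in steps of length
    less than the room [e] left by [rips_strict]: consecutive steps are contiguous
    maps into [rips s d], and the last one is constant. *)
Lemma rips_acyclic s d : s != fset0 -> 0 < d -> acyclic A (rips s d).
Proof.
move=> /fset0Pn[v0 v0s] d0 z zd z0.
pose c : V -> R := fun v => (v == v0)%:R.
have cs : in_simplex s c.
  split=> [v|v vs|]; first exact: ler0n.
    by rewrite /c; case: eqP vs => // ->; rewrite v0s.
  rewrite (bigD1_seq v0) ?fset_uniq //= /c eqxx big1 ?addr0 // => v.
  by move=> /negPf ->.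
have [e e0 ze] := rips_strict d0 zd.
have [m m0 me] := fine_grid e0.
pose f (j : nat) := segment c (j%:R / m%:R).
have m0R : 0 < m%:R :> R by rewrite ltr0n.
have ge01 j : (j <= m)%N -> 0 <= j%:R / m%:R <= (1 : R).
  move=> jm; rewrite divr_ge0 ?ler0n //= ler_pdivrMr // mul1r ler_nat //.
have [j jm|b bd_ bE] :=
    @homologous_path A _ (rips s d) (fun j => push (f j) z) m.
  apply: (@contiguous_homology _ _ _ _ _ (rips s (d - e))) ze z0 => t u [ts td] ut.
  have uE x : x \in u -> exists y a, [/\ y \in t, 0 <= a <= 1,
      x = segment c a y & a = j%:R / m%:R \/ a = j.+1%:R / m%:R].
    move=> /ut; rewrite mem_cat => /orP[] /mapP[y yt ->].
      by exists y, (j%:R / m%:R); split=> //; [rewrite ge01 // ltnW|left].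
    by exists y, (j.+1%:R / m%:R); split=> //; [rewrite ge01|right].
  split=> [x /uE[y [a [yt a01 -> _]]]|x y v /uE[x' [a [x't a01 -> aE]]]].
    by apply: in_simplex_segment => //; exact: ts.
  move=> /uE[y' [a' [y't a'01 -> a'E]]].
  have aa' : `|a' - a| < e.
    by case: aE a'E => [->|->] [->|->]; rewrite ?subrr ?normr0 // distrC.
  have -> : segment c a x' v - segment c a' y' v =
      (1 - a) * (x' v - y' v) + (a' - a) * (y' v - c v).
    by rewrite /segment; ring.
  apply: le_lt_trans (ler_normD _ _) _; rewrite !normrM.
  have h1 : `|1 - a| * `|x' v - y' v| <= `|x' v - y' v|.
    by rewrite ler_piMl // ler_norml; move: a01 => /andP[]; lra.
  have h2 : `|a' - a| * `|y' v - c v| <= `|a' - a|.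
    rewrite ler_piMr // ler_norml.
    have := in_simplex_le1 v (ts _ y't); have := in_simplex_le1 v cs.
    by have [+ _ _] := ts _ y't; have [+ _ _] := cs => /(_ v) + /(_ v); lra.
  by have := td x' y' v x't y't; lra.
pose L := [set u : seq (V -> R) | forall x, x \in u -> x = c].
have [|||b' Lb' b'E] := @cone_acyclic A _ L c _ (push (f m) z).
- by move=> u Lu x; rewrite inE => /predU1P[//|/Lu].
- apply: carried_push zd => t _ x /mapP[y _ ->]; apply/funext => v.
  by rewrite /f divff ?gt_eqF // /segment subrr mul0r add0r mul1r.
- by rewrite bd_push z0 linear0.
exists (b' - b).
  apply: carriedB => //; apply: (carriedW Lb') => u Lu; split=> [x /Lu->//|].
  by move=> x y v /Lu-> /Lu->; rewrite subrr normr0.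
rewrite linearB /= bE b'E opprB addrC subrK push_id // => x.
by apply/funext => v; rewrite /f /segment mul0r subr0 mul1r mul0r addr0.
Qed.

End Rips.

(** * Lebesgue numbers *)

Lemma ptws_box (R : realType) (V : choiceType) (x : {ptws V -> R})
    (l : seq V) (e : R) : 0 < e ->
  nbhs x [set f : {ptws V -> R} | forall w, w \in l -> `|x w - f w| < e].
Proof.
move=> e0; elim: l => [|w l IH].
  suff -> : [set f : {ptws V -> R} |
      forall w, w \in [::] -> `|x w - f w| < e] = setT by exact: filterT.
  by apply/seteqP; split.
have wx : nbhs x [set f : {ptws V -> R} | `|x w - f w| < e].
  have := @proj_continuous V (fun=> R) w x [set b | `|x w - b| < e].
  by apply; apply: (nbhsx_ballx (x w) e e0).
apply: (filterS _ (filterI wx IH)) => f [fw fl] u.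
by rewrite inE => /predU1P[->//|]; apply: fl.
Qed.

Section Points.
Context (R : realType) (V : choiceType) (K : complex V).
Local Notation rK := (realization R K).

(** Vertices whose open stars have a common point span a simplex. *)
Lemma bary_pos (p : rK) (u : seq V) : (forall v, v \in u -> 0 < p v) ->
  u = [::] \/ K [fset v in u]%fset.
Proof.
case: u => [|v u] up; [by left|right].
have [s [Ks ps p0 p1]] := baryP p; apply: simplex_face Ks _ _.
  apply/fsubsetP => w; rewrite !inE => wu; have := up w; rewrite inE wu => /(_ isT).
    by apply: contraLR => /p0 ->; rewrite ltxx.
by apply/fset0Pn; exists v; rewrite !inE eqxx.
Qed.

Lemma bary_pos_ex (p : rK) : exists v, 0 < p v.
Proof.
have [s [Ks ps p0 p1]] := baryP p.
have /fset0Pn[v /ps] := simplex_neq0 Ks; by exists v.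
Qed.

Lemma point_of s x : K s -> in_simplex s x -> exists p : rK, bary p = x.
Proof.
move=> Ks [x0 xs x1].
suff xP : exists s : {fset V}, [/\ K s, (forall v, v \in s -> 0 < x v),
    (forall v, v \notin s -> x v = 0) & \sum_(v <- s) x v = 1].
  by exists (Point xP).
pose s' := [fset v in s | 0 < x v]%fset.
have s's : (s' `<=` s)%fset by apply/fsubsetP => v; rewrite !inE => /andP[].
have s'0 v : v \notin s' -> x v = 0.
  rewrite !inE negb_and => /orP[/xs//|]; rewrite -leNgt => xv.
  by apply/eqP; rewrite eq_le xv x0.
have s'1 : \sum_(v <- s') x v = 1.
  by rewrite -x1; apply: big_fset_incl => // v _; exact: s'0.
exists s'; split=> //; last by move=> v; rewrite !inE => /andP[].
apply: simplex_face Ks s's _; apply/eqP => s'E; move: s'1.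
by rewrite s'E big_seq_fset0 => /eqP; rewrite eq_sym oner_eq0.
Qed.

Context (x0 : rK).

Definition pt (x : V -> R) : rK :=
  if pselect (exists p : rK, bary p = x) is left e then projT1 (cid e) else x0.

Lemma ptE s x : K s -> in_simplex s x -> bary (pt x) = x.
Proof.
move=> Ks xs; rewrite /pt; case: pselect => [e|[]]; first exact: projT2 (cid e).
exact: point_of xs.
Qed.

Lemma open_star v : open [set p : rK | 0 < p v].
Proof.
move=> s Ks x /= xv xs; exists (x v) => // y ys xy.
by have := xy v; rewrite ltr_distl => /andP[]; lra.
Qed.

Context (h : rK * R -> rK) (hC : {within setT `*` `[0, 1], continuous h}).
Context (S : seq {fset V}) (SK : forall s, s \in S -> K s).

(** [v] is a good label for the point [(x, a)]: near it, the homotopy stays in the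
    open star of [v]. *)
Definition close d (x : V -> R) (a : R) (v : V) :=
  forall s y b, s \in S -> in_simplex s y -> 0 <= b <= 1 ->
    (forall w, `|x w - y w| < d) -> `|a - b| < d -> 0 < h (pt y, b) v.

(** The weak topology only controls one closed simplex of [K] at a time; but
    closed simplices of [S] that do not contain [p] stay at a positive distance
    from [p], and [S] is finite. *)
Lemma star_nbhs (p : rK) (a : R) : 0 <= a <= 1 ->
  exists v, exists2 e : R, 0 < e & close e p a v.
Proof.
move=> a01; have [v hv] := bary_pos_ex (h (p, a)); exists v.
have /subspace_continuousP /(_ (p, a)) := hC.
have pA : (setT `*` `[0, 1]) (p, a) by split=> //=; rewrite in_itv /=.
move=> /(_ pA) /(_ [set q : rK | 0 < q v]).
have /[swap]/[apply] : nbhs (h (p, a)) [set q : rK | 0 < q v].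
  by apply: open_nbhs_nbhs; split=> //; exact: open_star.
rewrite /fmap /= /filter.within /= => -[[U W] /= [pU aW] UW].
move: pU; rewrite nbhsE /= => -[U' [oU' U'p] U'U].
have [e /= e0 eW] := aW.
have [s e1 e2 He1 /andP[e20 e21]|s sS|e' e'0 He'] := @uniform_eps R _ S (fun s e => 
   forall y, in_simplex s y -> (forall w, `|p w - y w| < e) -> U' (pt y)).
- move=> y ys py; apply: He1 => // w; exact: lt_le_trans (py w) _.
- have Ks := SK sS.
  have [ps|/existsNP[v0 /not_implyP[v0s /eqP pv0]]] :=
    pselect (forall v, v \notin s -> p v = 0).
    have [e1 e10 He1] := oU' s Ks p U'p ps; exists e1 => // y ys py.
    apply: He1; last by rewrite (ptE Ks ys).
    by move=> w ws; rewrite (ptE Ks ys); have [_ ->] := ys.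
  exists `|p v0|; first by rewrite normr_gt0.
  by move=> y [_ ys _] /(_ v0); rewrite ys // subr0 ltxx.
exists (Num.min e e'); first by rewrite lt_min e0.
move=> s y b sS ys b01 py ab.
apply: (UW (pt y, b)).
  split=> /=.
    apply: U'U; apply: He' ys _ => // w.
    by apply: lt_le_trans (py w) _; rewrite ge_min lexx orbT.
  by apply: eW; rewrite /= (lt_le_trans ab) // ge_min lexx.
by split=> //=; rewrite in_itv.
Qed.

(** The sup distance and pointwise convergence agree on one closed simplex; the
    latter makes Tychonoff's theorem available. *)
Lemma in_simplex_compact (s : {fset V}) :
  compact (in_simplex s : set {ptws V -> R}).
Proof.
pose I v : set R := if v \in s then [set` `[0, 1]%R] else [set 0].
pose B := [set f : {ptws V -> R} | forall v, I v (f v)].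
have cB : compact B.
  apply: (@tychonoff V (fun=> R) I) => v; rewrite /I.
  by case: ifP => _; [exact: segment_compact|exact: compact_set1].
have clS : closed [set f : {ptws V -> R} | \sum_(v <- s) f v = 1].
  apply: (@preimage_closed _ _ _ [set 1 : R]); last exact: closed_eq.
  move=> f _; move: f; apply: (@continuous_big _ _ _ _ xpredT) => [|v _].
    exact: add_continuous.
  exact: (@proj_continuous V (fun=> R) v).
suff -> : in_simplex s = B `&` [set f | \sum_(v <- s) f v = 1].
  exact: compact_closedI.
apply/seteqP; split=> [f fs|f [fB f1]].
  have [f0 fs0 f1] := fs; split=> // v; rewrite /I.
  case: ifPn => [_|vs]; last by rewrite /= fs0.
  by rewrite /= in_itv /= f0 (in_simplex_le1 v fs).
split=> // [v|v vs]; have := fB v; rewrite /I.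
  by case: ifP => _ /=; [rewrite in_itv /= => /andP[]|move=> ->].
by rewrite (negPf vs).
Qed.

Lemma lebesgue : exists2 d : R, 0 < d & forall s x a, s \in S ->
  in_simplex s x -> 0 <= a <= 1 -> exists v, close d x a v.
Proof.
have [s e e' se /andP[e'0 e'e] x a xs a01|s sS|d d0 dP] := @uniform_eps R _ S
  (fun s d => forall x a, in_simplex s x -> 0 <= a <= 1 ->
    exists v, close d x a v).
- have [v xv] := se x a xs a01; exists v => s' y b s'S ys' b01 xy ab.
  by apply: xv ys' b01 _ _ => // [w|]; apply: lt_le_trans e'e.
- have /compact_near_coveringP cov :=
    compact_setX (@in_simplex_compact s) (@segment_compact R 0 1).
  have /cov : Filter (0^'+ : set_system R) by exact: _.
  move=> /(_ (fun d q => in_simplex s q.1 -> exists v, close d q.1 q.2 v)).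
  case=> [[x a] [/= xs]|e /= e0 eP].
    rewrite in_itv /= => a01.
    have Ks := SK sS; have [v [e e0 ev]] := star_nbhs (pt x) a01.
    rewrite (ptE Ks xs) in ev.
    have e20 : 0 < e / 2 by rewrite divr_gt0.
    exists ([set q : {ptws V -> R} * R |
      (forall w, w \in s -> `|x w - q.1 w| < e / 2) /\
      `|a - q.2| < e / 2], [set d : R | d < e / 2]).
      split=> /=; last by exact: nbhs_right_lt.
      exists ([set f : {ptws V -> R} |
        forall w, w \in s -> `|x w - f w| < e / 2], [set b | `|a - b| < e / 2]).
        split=> /=; first exact: ptws_box.
        exact: nbhsx_ballx.
      by move=> [f b] [].
    move=> [[x' a'] d] [[/= xx' aa'] de] x's; exists v.
    move=> s' y b s'S ys' b01 yx' ba'; apply: ev ys' b01 _ _ => // [w|].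
      have xx'w : `|x w - x' w| < e / 2.
        have [/xx'//|ws] := boolP (w \in s).
        have [_ -> //] := xs; have [_ -> //] := x's; by rewrite subrr normr0.
      by have := yx' w; have := ler_distD (x' w) (x w) (y w); lra.
    by have := ler_distD a' a b; lra.
  exists (e / 2); first by rewrite divr_gt0.
  move=> x a xs a01; apply: (eP (e / 2) _ _ (x, a)) => //=.
  - by rewrite sub0r normrN gtr0_norm ?divr_gt0 //; lra.
  - by rewrite divr_gt0.
by exists d => // s x a sS; exact: dP.
Qed.

End Points.

(** * Contractible complexes are acyclic *)

(** Entries may be repeated; the empty list carries the augmentation. *)
Definition ordered (V : choiceType) (K : complex V) : set (seq V) :=
  [set t | t = [::] \/ K [fset v in t]%fset].

Lemma ordered_sub (V : choiceType) (K : complex V) (t u : seq V) :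
  ordered K t -> {subset u <= t} -> ordered K u.
Proof.
move=> Kt; case: u => [|v u] ut; [by left|right].
case: Kt => [t0|Kt]; first by have := ut v; rewrite t0 inE eqxx => /(_ isT).
apply: simplex_face Kt _ _.
  by apply/fsubsetP => w; rewrite !inE => wu; apply: ut; rewrite inE.
by apply/fset0Pn; exists v; rewrite !inE eqxx.
Qed.

Lemma ordered_face (V : choiceType) (K : complex V) : face_closed (ordered K).
Proof. by move=> t u Kt ut; apply: ordered_sub Kt (mem_subseq ut). Qed.

(** A homotopy from the identity to a constant is made simplicial by labelling
    the points with vertices at a scale given by [lebesgue]. *)
Theorem contractible_acyclic (A : pzRingType) (R : realType) (V : choiceType)
  (K : complex V) : contractible R (realization R K) -> acyclic A (ordered K).
Proof.
move=> [x0 [h [hC h0 h1]]] c Kc c0.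
pose S := [seq [fset v in t]%fset | t <- supp c & t != [::]].
have SK s : s \in S -> K s.
  move=> /mapP[t]; rewrite mem_filter mem_supp => /andP[t0 /Kc[tE|Kt] ->] //.
  by rewrite tE in t0.
have [d d0 dP] := @lebesgue R V K x0 h hC S SK.
have [v0 v0x0] := bary_pos_ex x0.
have /choice[phi phiP] : forall q : R * (V -> R), exists v, forall s, s \in S ->
    in_simplex s q.2 -> 0 <= q.1 <= 1 -> @close R V K x0 h S d q.2 q.1 v.
  move=> q; have [[s [sS qs q01]]|nq] := pselect (exists s,
    [/\ s \in S, in_simplex s q.2 & 0 <= q.1 <= 1]).
    by have [v vq] := dP s q.2 q.1 sS qs q01; exists v.
  by exists v0 => s sS qs q01; case: nq; exists s.
(* The lists below those of [c]: bounded in length, as acyclic carriers need. *)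
pose T : set (seq V) := [set t | exists2 t', t' \in supp c & subseq t t'].
pose Phi (t : seq V) := rips [fset v in t]%fset d.
have faceT : face_closed T.
  by move=> t u [t' ct' tt'] ut; exists t' => //; exact: subseq_trans tt'.
have cT : carried T c by move=> t ct; exists t => //; rewrite mem_supp.
have TS t : T t -> t != [::] ->
    exists2 s, s \in S & ([fset v in t]%fset `<=` s)%fset.
  move=> [t' ct' tt'] t0; exists [fset v in t']%fset; last first.
    by apply/fsubsetP => w; rewrite !inE; exact: (mem_subseq tt').
  apply: map_f; rewrite mem_filter ct' andbT; case: t' tt' {ct'} => //.
  by rewrite subseq0 (negPf t0).
have TK : T `<=` ordered K.
  move=> t [t' ct' tt']; apply: ordered_face tt'; apply: Kc.
  by rewrite -mem_supp.
pose n := (\max_(t <- supp c) size t)%N.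
have Tn t : T t -> (size t <= n)%N.
  move=> [t' ct' /size_subseq/leq_trans]; apply.
  by apply: (@leq_bigmax_seq _ _ xpredT size).
have Phi_mono t u : T t -> subseq u t -> Phi u `<=` Phi t.
  move=> _ ut q [qs qd]; split=> // x /qs; apply: in_simplexS.
  by apply/fsubsetP => w; rewrite !inE; exact: (mem_subseq ut).
have Phi_ac t : T t -> t != [::] -> acyclic A (Phi t).
  move=> _ t0; apply: rips_acyclic => //.
  case: t t0 => // v t _; apply/fset0Pn; exists v.
  by rewrite !inE eqxx.
have Phi0 : Phi [::] [::] by split.
have [sd [sd0 sdP bd_sd]] := @acyclic_chain_map A _ _ T Phi n faceT Tn Phi_mono
  Phi_ac Phi0.
pose U : set (seq (V -> R)) := [set q | exists2 t, T t & Phi t q].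
have sdU : carried U (sd c).
  apply: carried_lin cT => t Tt; apply: (carriedW (sdP t Tt)) => q tq.
  by exists t.
have sd_c0 : bd (sd c) = 0 by rewrite bd_sd // c0 linear0.
have UP q : U q -> q != [::] -> exists2 s, s \in S & rips s d q.
  move=> [t Tt [qs qd]] q0.
  have t0 : t != [::].
    apply/eqP => tE; case: q q0 qs {qd} => // x q _ /(_ x).
    rewrite inE eqxx => /(_ isT)[_ _]; rewrite tE.
    have -> : [fset v in [::] : seq V]%fset = fset0.
      by apply/fsetP => v; rewrite !inE.
    by rewrite big_seq_fset0 => /eqP; rewrite eq_sym oner_eq0.
  have [s sS ts] := TS t Tt t0; exists s => //; split=> // x /qs.
  exact: in_simplexS.
(* The images at times [a] and [b] of a small list [y :: q] are vertices whose
   open stars contain the point at time [a] of the track of [y]. *)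
have phiU q a b u : U q -> 0 <= a <= 1 -> 0 <= b <= 1 -> `|a - b| < d ->
    {subset u <= map (fun x => phi (a, x)) q ++ map (fun x => phi (b, x)) q} ->
    ordered K u.
  move=> Uq a01 b01 ab uq; have [qE|/(UP q Uq)[s sS [qs qd]]] := eqVneq q [::].
    case: u uq => [|v u] uq; [by left|].
    by have := uq v; rewrite qE inE eqxx => /(_ isT).
  case: q {Uq} => [|y q] in uq qs qd *.
    case: u uq => [|v u] uq; [by left|].
    by have := uq v; rewrite inE eqxx => /(_ isT).
  have yq : y \in y :: q by rewrite inE eqxx.
  apply: (@bary_pos R V K (h (pt x0 y, a))) => w /uq.
  rewrite mem_cat => /orP[] /mapP[x xq ->].
    apply: (phiP (a, x) s sS (qs x xq) a01 s y a sS) => //=; first exact: qs.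
      by move=> w'; apply: qd.
    by rewrite subrr normr0.
  apply: (phiP (b, x) s sS (qs x xq) b01 s y a sS) => //=; first exact: qs.
    by move=> w'; apply: qd.
  by rewrite distrC.
have [m m0 me] := fine_grid d0.
have ge01 j : (j <= m)%N -> 0 <= j%:R / m%:R <= (1 : R).
  by move=> jm; rewrite divr_ge0 ?ler0n //= ler_pdivrMr ?ltr0n // mul1r ler_nat.
pose Phij (j : nat) := push (fun x => phi (j%:R / m%:R, x)) (sd c).
have [j jm|d1 Kd1 d1E] := @homologous_path A V (ordered K) Phij m.
  apply: (@contiguous_homology _ _ _ _ _ U) => // q u Uq uq.
  apply: (@phiU q (j%:R / m%:R) (j.+1%:R / m%:R)) => //; rewrite ?ge01 //.
    exact: ltnW.
  by rewrite distrC.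
(* [h] is the identity at time 0, so labels have a positive coordinate there. *)
have phi0 t q x : T t -> Phi t q -> x \in q -> phi (0, x) \in t.
  move=> Tt tq xq; have Uq : U q by exists t.
  have q0 : q != [::] by case: q xq {tq Uq}.
  have [s sS [qs qd]] := UP q Uq q0.
  have := phiP (0, x) s sS (qs x xq).
  rewrite lexx ler01 => /(_ isT s x 0 sS (qs x xq)) /=.
  rewrite lexx ler01 subrr normr0 h0 => /(_ isT) phix.
  have /phix/(_ d0) : forall w, `|x w - x w| < d.
    by move=> w; rewrite subrr normr0.
  rewrite (ptE _ (SK s sS) (qs x xq)).
  have [_ xt _] := tq.1 x xq; apply: contraLR => xnt; rewrite xt ?ltxx //.
  by rewrite inE.
pose f : {linear free A (seq V) -> free A (seq V)} :=
  push (fun x => phi (0, x)) \o sd.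
have fT t : T t ->
    carried [set u : seq V | {subset u <= t}] (f (delta A t)).
  move=> Tt; apply: carried_push (sdP t Tt) => q tq w /mapP[x xq ->].
  exact: phi0 tq xq.
have bdf t : T t -> t != [::] -> bd (f (delta A t)) = f (bd (delta A t)).
  by move=> Tt _; rewrite /= bd_push bd_sd //; exact: carried_delta.
have f0 : f (delta A [::]) = delta A [::] by rewrite /= sd0 push_delta.
have TsubK t u : T t -> {subset u <= t} -> ordered K u.
  by move=> /TK; exact: ordered_sub.
have [||d2 Kd2 d2E] := carried_by_simplices faceT TsubK fT bdf f0 (c := c) => //.
  by rewrite c0; exact: carried0.
(* At time 1, all labels are vertices of the simplex that carries [x0]. *)
pose L := [set u : seq V | forall v, v \in u -> 0 < x0 v].
have [|||d3 Ld3 d3E] := @cone_acyclic A V L v0 _ (Phij m).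
- by move=> u Lu w; rewrite inE => /predU1P[->|/Lu].
- apply: carried_push sdU => q Uq w /mapP[x xq ->].
  have q0 : q != [::] by case: q xq {Uq}.
  have [s sS [qs qd]] := UP q Uq q0.
  rewrite divff ?pnatr_eq0 -?lt0n //.
  have := phiP (1, x) s sS (qs x xq); rewrite lexx ler01.
  move=> /(_ isT s x 1 sS (qs x xq)) /=; rewrite lexx ler01 subrr normr0 h1.
  by apply=> // w'; rewrite subrr normr0.
- by rewrite bd_push sd_c0 linear0.
exists (d2 + d3 - d1).
  apply: carriedB => //; apply: carriedD => //; apply: (carriedW Ld3) => u.
  exact: bary_pos.
rewrite linearB linearD /= d2E d3E d1E /Phij mul0r.
by rewrite opprB addrA addrAC addrK subrK.
Qed.

(** * Oriented chains *)

(** The total order selects one ordering of each simplex, compatible with faces. *)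
Lemma total_order_exists (T : eqType) :
  exists r : rel T, [/\ total r, antisymmetric r & transitive r].
Proof.
have [r rwo] := wochoice.well_ordering_principle T; exists r.
have ne (s : seq T) x : x \in s -> wochoice.nonempty [in s] by move=> xs; exists x.
have rtot : total r.
  move=> x y; have [|z [[+ zmin] _]] := rwo [in [:: x; y]].
    by apply: (ne _ x); rewrite inE eqxx.
  rewrite !inE => /orP[] /eqP zE; apply/orP; [left|right]; rewrite -zE;
  by apply: zmin; rewrite !inE eqxx ?orbT.
have ranti : antisymmetric r.
  move=> x y /andP[xy yx]; have [|z [_ zu]] := rwo [in [:: x; y]].
    by apply: (ne _ x); rewrite inE eqxx.
  have rr w : r w w by have := rtot w w; rewrite orbb.
  have <- : z = x.
    apply: zu; split=> [|w]; first by rewrite !inE eqxx.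
    by rewrite !inE => /orP[] /eqP ->.
  apply: zu; split=> [|w]; first by rewrite !inE eqxx orbT.
  by rewrite !inE => /orP[] /eqP ->.
split=> // y x z xy yz.
have [|w [[+ wmin] _]] := rwo [in [:: x; y; z]].
  by apply: (ne _ x); rewrite inE eqxx.
have wx : r w x by apply: wmin; rewrite !inE eqxx.
have wy : r w y by apply: wmin; rewrite !inE eqxx !orbT.
have wz : r w z by apply: wmin; rewrite !inE eqxx !orbT.
rewrite !inE => /or3P[] /eqP wE; first by rewrite -wE.
  by rewrite (ranti x y) // xy -wE.
by rewrite -(ranti y z) // yz -wE.
Qed.

Section Elem.
Context (A : pzRingType) (V : choiceType) (n : nat).
Implicit Types t u : n.+1.-tuple V.

Definition reorder t (s : 'S_n.+1) : n.+1.-tuple V :=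
  [tuple tnth t (s i) | i < n.+1].

Lemma reorderM t s s' : reorder (reorder t s) s' = reorder t (s' * s)%g.
Proof. by apply: eq_from_tnth => i; rewrite !tnth_mktuple permM. Qed.

Lemma reorder1 t : reorder t 1%g = t.
Proof. by apply: eq_from_tnth => i; rewrite !tnth_mktuple perm1. Qed.

Lemma perm_reorder t s : perm_eq (reorder t s) t.
Proof. by apply/tuple_permP; exists s. Qed.

Lemma reorder_uniq t s : uniq t -> reorder t s = t -> s = 1%g.
Proof.
move=> /tuple_uniqP tU tE; apply/permP => i; rewrite perm1; apply: tU.
by rewrite -{2}tE tnth_mktuple.
Qed.

Lemma elem_reorder t s u : elem A t (reorder u s) = (-1) ^+ s * elem A t u.
Proof.
rewrite /elem mulr_sumr (reindex_inj (mulgI s)) /=; apply: eq_big => [s'|s' _].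
  apply/eqP/eqP => [us|->]; last by rewrite -/(reorder t s') reorderM.
  rewrite -(reorder1 u) -(mulVg s) -reorderM us -/(reorder t _) reorderM.
  by rewrite mulgA mulVg mul1g.
by rewrite odd_permM signr_addb.
Qed.

Lemma elem_neq0 t u : elem A t u != 0 -> exists s, u = reorder t s.
Proof.
apply: contraNP => /forallNP nu; rewrite /elem big1 // => s /eqP us.
by case: (nu s).
Qed.

Lemma elem_perm t u : elem A t u != 0 -> perm_eq u t.
Proof. by move=> /elem_neq0[s ->]; exact: perm_reorder. Qed.

(** The signs of [s] and of [s] times a transposition of two equal entries cancel;
    pairing the terms, rather than saying that the sum is its own opposite, is
    also valid in characteristic two. *)
Lemma elem_nonuniq t u : ~~ uniq t -> elem A t u = 0.
Proof.
move=> /tuple_uniqP tU.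
have /existsNP[i /existsNP[j /not_implyP[tij /eqP ij]]] := tU.
rewrite /elem (bigID (@odd_perm _)) /=; apply: canLR (subrK _) _.
rewrite add0r -sumrN (reindex_inj (mulIg (tperm i j))) /=.
apply: eq_big => [s|s /andP[_]]; last first.
  by rewrite odd_permM odd_tperm ij addbT signrN.
rewrite odd_permM odd_tperm ij addbT; congr (_ && _); congr (_ == _).
apply: eq_from_tnth => k; rewrite !tnth_mktuple permM.
by case: tpermP => // ->.
Qed.

Lemma elem_chain (K : complex V) t : K [fset v in tval t]%fset ->
  chain K (elem A t).
Proof.
move=> Kt; split.
- apply: (@sub_finite_set _ _ (range (reorder t))).
    by move=> u /= /elem_neq0[s ->]; exists s.
  by apply: finite_image; exact: finite_finset.
- move=> u ut0; have ut := elem_perm ut0; split.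
    rewrite (perm_uniq ut); apply: contraNT ut0 => tU.
    by rewrite elem_nonuniq.
  rewrite (_ : [fset v in tval u]%fset = [fset v in tval t]%fset) //.
  by apply/fsetP => v; rewrite !inE (perm_mem ut).
- by move=> u s; exact: elem_reorder.
Qed.

Lemma elem_uniq t : uniq t -> elem A t t = 1.
Proof.
move=> tU; rewrite /elem (bigD1 (1%g : 'S_n.+1)) /= -/(reorder t 1%g) ?reorder1 //.
rewrite odd_perm1 expr0 big1 ?addr0 // => s /andP[/eqP ts /eqP[]].
exact: (@reorder_uniq t).
Qed.

End Elem.

Section Orient.
Context (A : pzRingType) (V : choiceType).
Context (r : rel V) (rtot : total r) (ranti : antisymmetric r)
  (rtr : transitive r).

Definition increasing (t : seq V) := uniq t && sorted r t.

Lemma increasing_subseq t u : subseq u t -> increasing t -> increasing u.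
Proof.
move=> ut /andP[tU ts]; rewrite /increasing (subseq_uniq ut) //.
exact: subseq_sorted ts.
Qed.

Lemma increasing_perm t u : increasing t -> increasing u -> perm_eq t u -> t = u.
Proof. by move=> /andP[_ ts] /andP[_ us]; exact: (sorted_eq rtr ranti). Qed.

Section Degree.
Context (n : nat).
Local Notation fn := (n.+1.-tuple V -> A^o).

Definition orient : free A (seq V) -> fn :=
  ext (fun t => if insub t is Some u then elem A (u : n.+1.-tuple V) else 0).

HB.instance Definition _ := GRing.Linear.on orient.

Lemma orient_tuple (t : n.+1.-tuple V) : orient (delta A (tval t)) = elem A t.
Proof. by rewrite /orient ext_delta valK. Qed.

Lemma orient_size t : size t != n.+1 -> orient (delta A t) = 0.
Proof. by move=> tn; rewrite /orient ext_delta insubN. Qed.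

(** The default value of [insubd] is taken only when the restriction has infinite
    support, which does not happen for chains. *)
Definition increasing_part (c : fn) : free A (seq V) :=
  insubd (0 : free A (seq V)) (fun t : seq V =>
    if insub t is Some u then
      if increasing t then c (u : n.+1.-tuple V) else 0 else 0 : A^o).

Lemma coef_increasing_part (c : fn) t : finite_set [set u | c u != 0] ->
  coef (increasing_part c) t = if insub t is Some u then
      if increasing t then c (u : n.+1.-tuple V) else 0 else 0.
Proof.
move=> finc; rewrite /coef val_insubd ifT //; apply/asboolP.
apply: (@sub_finite_set _ _ (@tval _ _ @` [set u | c u != 0])).
  move=> u /=; case: insubP => [u' _ <-|_]; last by rewrite eqxx.
  by case: ifP => _; [exists u'|rewrite eqxx].
exact: finite_image.
Qed.

Lemma increasing_partP a (c d : fn) :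
  finite_set [set u | c u != 0] -> finite_set [set u | d u != 0] ->
  increasing_part (a *: c + d) = a *: increasing_part c + increasing_part d.
Proof.
move=> finc find.
have fincd : finite_set [set u | (a *: c + d) u != 0].
  apply: (@sub_finite_set _ _ ([set t | c t != 0] `|` [set t | d t != 0])).
    move=> t /=; rewrite -[(a *: c + d) t]/(a * c t + d t) => abc0.
    have [bt0|] := eqVneq (c t) 0; last by left.
    by right; move: abc0; rewrite bt0 mulr0 add0r.
  by rewrite finite_setU.
apply: freeP => t; rewrite coefD coefZ !coef_increasing_part //.
case: insub => [u|]; last by rewrite mulr0 addr0.
by case: ifP => // _; rewrite mulr0 addr0.
Qed.

Lemma increasing_part0 : increasing_part 0 = 0.
Proof.
apply: freeP => t; rewrite coef_increasing_part ?coef0.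
  by case: insub => // u; case: ifP.
by apply: (sub_finite_set _ (finite_set0 _)) => u /=; rewrite eqxx.
Qed.

End Degree.
End Orient.
Arguments orient {A V} n.

Definition full_complex (V : choiceType) : complex V :=
  @Complex V (fun s => s != fset0) (fun s s0 => s0) (fun _ _ _ _ t0 => t0).

Lemma ordered_full (V : choiceType) (t : seq V) : ordered (full_complex V) t.
Proof.
case: t => [|v t]; [by left|right]; apply/fset0Pn; exists v.
by rewrite !inE eqxx.
Qed.

Section OrientTheory.
Context (A : pzRingType) (V : choiceType).
Implicit Types (K : complex V) (c : free A (seq V)).

Lemma bd_expand (t : seq V) : bd (delta A t) =
  \sum_(i < size t) (-1) ^+ i *: delta A (take i t ++ drop i.+1 t).
Proof.
elim: t => [|v t IH]; first by rewrite bd_nil big_ord0.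
rewrite bd_cons IH [RHS](big_ord_recl (size t)) expr0 scale1r ?take0 ?drop0.
rewrite (linear_sum (cone v)) -sumrN; congr (_ + _); first by rewrite /= drop0.
apply: eq_bigr => i _.
by rewrite linearZ /= cone_delta /bump leq0n add1n exprS mulN1r scaleNr.
Qed.

Lemma orient_chain K n c : carried (ordered K) c -> chain K (orient n c).
Proof.
move: c; apply: carried_ind => [|a t c Kt Kc]; first by rewrite linear0; exact: chain0.
rewrite linearP /=; apply: chain_submod => //.
have [tn|tn] := eqVneq (size t) n.+1; last first.
  by rewrite orient_size //; exact: chain0.
rewrite -[t]/(tval (Tuple (introT eqP tn))) orient_tuple; apply: elem_chain.
by case: Kt tn => [->|].
Qed.

Lemma tuple_lift n (u : n.+2.-tuple V) (i : 'I_n.+2) :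
  take i u ++ drop i.+1 u = [tuple tnth u (lift i j) | j < n.+1].
Proof.
have su := size_tuple u.
have iu : (i <= n.+1)%N by rewrite -ltnS.
have si : size (take i u) = i by rewrite size_takel // su ltnW.
apply: (@eq_from_nth _ (thead u)) => [|j].
  by rewrite size_cat si size_drop su size_tuple subSS subnKC.
rewrite size_cat si size_drop su subSS subnKC // => jn.
rewrite -[j in RHS]/(nat_of_ord (Ordinal jn)) -tnth_nth tnth_mktuple.
rewrite (tnth_nth (thead u)) /= nth_cat si /bump.
have [ij|ji] := leqP i j.
  by rewrite nth_drop add1n addSn subnKC.
by rewrite nth_take.
Qed.

(** [boundary_elem] expands the boundary of an oriented simplex by the same
    alternating sum as [bd_expand]. *)
Lemma boundary_orient n c : boundary (orient n.+1 c) = orient n (bd c).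
Proof.
elim/free_ind: c => [|a t c IH]; first by rewrite !linear0 boundary0.
have chF (b : free A (seq V)) : chain (full_complex V) (orient n.+1 b).
  by apply: (@orient_chain _ n.+1 b) => u _; exact: ordered_full.
rewrite linearP /= (boundary_linear _ (chF _) (chF _)) IH !linearP /=.
congr (_ *: _ + _).
have [tn|tn] := eqVneq (size t) n.+2; last first.
  rewrite orient_size // boundary0; symmetry.
  pose z : {linear free A (seq V) -> n.+1.-tuple V -> A^o} := \0.
  apply: (eq_lin (g := z)) (@bd_face A V t) => u [_ ut] /=.
  by rewrite orient_size // -eqSS ut.
pose u := Tuple (introT eqP tn).
rewrite -[t]/(tval u) orient_tuple boundary_elem bd_expand linear_sum tn.
apply: eq_bigr => i _; rewrite linearZ /=.
by rewrite (tuple_lift u) orient_tuple.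
Qed.

Context (r : rel V) (rtot : total r) (ranti : antisymmetric r)
  (rtr : transitive r).
Local Notation part := (increasing_part r).

Lemma increasing_part_elem n (t : n.+1.-tuple V) : increasing r t ->
  part (elem A t) = delta A (tval t).
Proof.
move=> tI; have [fint _ _] := @elem_chain A V n (full_complex V) t
  (ltac:(by have [tE|//] := ordered_full (tval t);
    have := size_tuple t; rewrite tE)).
apply: freeP => u; rewrite coef_increasing_part // coef_delta.
case: insubP => [w _ <-|un]; last first.
  by have [uE|//] := eqVneq u (tval t); rewrite uE size_tuple eqxx in un.
rewrite val_eqE; case: ifPn => [wI|].
  have [->|wt] := eqVneq w t; first by rewrite elem_uniq //; case/andP: tI.
  apply/eqP; apply: contraNT wt => /elem_perm wt; apply/eqP/val_inj.
  exact: (increasing_perm ranti rtr).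
by case: eqP => // ->; rewrite tI.
Qed.

Lemma orient_finite n c : finite_set [set u | @orient A V n c u != 0].
Proof.
by have [] := @orient_chain (full_complex V) n c (fun t _ => ordered_full t).
Qed.

Lemma increasing_part_orient n c :
  carried [set t | size t = n.+1 /\ increasing r t] c ->
  part (orient n c) = c.
Proof.
move: c; apply: carried_ind => [|a t c [tn tI] IH].
  by rewrite linear0 increasing_part0.
rewrite linearP /= increasing_partP ?IH; try exact: orient_finite.
congr (_ *: _ + _); pose u := Tuple (introT eqP tn).
by rewrite -[t]/(tval u) orient_tuple increasing_part_elem.
Qed.

Lemma carried_increasing_part K n (c : n.+1.-tuple V -> A^o) : chain K c ->
  carried [set t | [/\ ordered K t, size t = n.+1 & increasing r t]] (part c).
Proof.
move=> [finc suppc _] t; rewrite coef_increasing_part //.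
case: insubP => [u _ <-|]; last by rewrite eqxx.
case: ifP; last by rewrite eqxx.
by move=> uI /suppc[_ Ku]; split=> //; [right|exact: size_tuple].
Qed.

Lemma increasing_part_inj K n (c : n.+1.-tuple V -> A^o) : chain K c ->
  part c = 0 -> c = 0.
Proof.
move=> [finc suppc altc] c0; apply/funext => t; apply/eqP; apply/negPn/negP.
move=> /[dup] /suppc[tU _] /negP; apply; apply/eqP.
have /tuple_permP[s sE] : perm_eq (sort r t) t by rewrite perm_sort.
have tsI : increasing r (reorder t s).
  by rewrite /increasing -sE sort_uniq tU sort_sorted.
have := altc t s; rewrite -/(reorder t s).
suff -> : c (reorder t s) = 0.
  by move=> /(congr1 ( *%R ((-1) ^+ s))); rewrite mulr0 signrMK => <-.
have := congr1 (fun b => coef b (tval (reorder t s))) c0.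
by rewrite coef_increasing_part // valK tsI coef0.
Qed.

(** An alternating chain is determined by its values on increasing tuples. *)
Lemma orient_increasing_part K n (c : n.+1.-tuple V -> A^o) : chain K c ->
  orient n (part c) = c.
Proof.
move=> Kc; have Kp := carried_increasing_part Kc.
have Ko : chain K (orient n (part c)).
  by apply: (@orient_chain K n (part c)); apply: (carriedW Kp) => t [].
have [finc _ _] := Kc; have [fino _ _] := Ko.
suff : -1 *: orient n (part c) + c = 0.
  by rewrite scaleN1r addrC => /eqP; rewrite subr_eq0 => /eqP.
apply: (increasing_part_inj (chain_submod (-1) Ko Kc)).
rewrite increasing_partP // increasing_part_orient ?scaleN1r ?addNr //.
by apply: (carriedW Kp) => t [].
Qed.

(** The boundary of the increasing part is itself supported on increasing lists,
    so it is determined by its image under [orient]. *)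
Lemma bd_increasing_part K n (c : n.+2.-tuple V -> A^o) : chain K c ->
  bd (part c) = part (boundary c).
Proof.
move=> Kc; rewrite -[in RHS](orient_increasing_part Kc) boundary_orient.
rewrite increasing_part_orient //.
apply: carried_lin (carried_increasing_part Kc) => t [_ tn tI].
apply: (carriedW (@bd_face A V t)) => u [ut un]; split.
  by apply: succn_inj; rewrite un tn.
exact: increasing_subseq ut tI.
Qed.

(** The composite of [orient] and its section, extended to the empty list. *)
Definition straighten_simplex (t : seq V) : free A (seq V) :=
  if t == [::] then delta A [::]
  else part (orient (size t).-1 (delta A t)).

Definition straighten : free A (seq V) -> free A (seq V) := ext straighten_simplex.

HB.instance Definition _ := GRing.Linear.on straighten.

Lemma straighten_orient n c : carried [set t | size t = n.+1] c ->
  straighten c = part (orient n c).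
Proof.
move: c; apply: carried_ind => [|a t c tn IH].
  by rewrite !linear0 increasing_part0.
rewrite !linearP /= increasing_partP ?IH; try exact: orient_finite.
congr (_ *: _ + _); rewrite /straighten ext_delta /straighten_simplex tn.
by case: eqP tn => [->|].
Qed.

Lemma bd_size n c : carried [set t | size t = n.+1] c ->
  carried [set t | size t = n] (bd c).
Proof.
apply: carried_lin => t tn; apply: (carriedW (@bd_face A V t)) => u [_ un].
by apply: succn_inj; rewrite un tn.
Qed.

Lemma straighten_homotopy K c : carried (ordered K) c ->
  carried [set [::]] (bd c) ->
  exists2 d, carried (ordered K) d & bd d = c - straighten c.
Proof.
move=> Kc c0; apply: (carried_by_simplices (@ordered_face V K) _ _ _ _ Kc c0).
- exact: ordered_sub.
- move=> t _ /=; rewrite /straighten ext_delta /straighten_simplex.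
  case: eqP => [->|/eqP t0]; first exact: carried_delta.
  have tn : size t = (size t).-1.+1 by case: (t) t0.
  pose w := Tuple (introT eqP tn).
  rewrite -[t in delta A t]/(tval w) orient_tuple => u.
  rewrite coef_increasing_part; last first.
    by rewrite -orient_tuple; exact: orient_finite.
  case: insubP => [u' _ <-|]; last by rewrite eqxx.
  case: ifP => _; last by rewrite eqxx.
  by move=> /elem_perm uw x; rewrite (perm_mem uw).
- move=> t _ t0.
  case: t t0 => // v [|w t] _.
    rewrite /= bd_cons bd_nil linear0 subr0 /straighten !ext_delta /straighten_simplex /=.
    rewrite -[[:: v]]/(tval [tuple v]) orient_tuple increasing_part_elem //=.
    by rewrite bd_cons bd_nil linear0 subr0.
  set u := v :: w :: t; have un : size u = (size t).+2 by [].
  rewrite /= (straighten_orient (n := (size t).+1) (c := delta A u)); last first.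
    exact: carried_delta.
  rewrite (straighten_orient (n := size t) (c := bd (delta A u))).
    rewrite (@bd_increasing_part (full_complex V)) ?boundary_orient //.
    by apply: (@orient_chain _ _ (delta A _)) => x _; exact: ordered_full.
  by apply: bd_size; exact: carried_delta.
- by rewrite /= /straighten ext_delta.
Qed.

End OrientTheory.

(** * Bicomplexes *)

Section Filtration.
Context (A : pzRingType) (B : choiceType).
Implicit Types c d : free A B.

Definition project (P : pred B) : free A B -> free A B :=
  ext (fun b => if P b then delta A b else 0).

HB.instance Definition _ P := GRing.Linear.on (project P).

Lemma coef_project P c b : coef (project P c) b = if P b then coef c b else 0.
Proof.
elim/free_ind: c => [|a b' c IH]; first by rewrite linear0 coef0 if_same.
rewrite linearP /= !coefD !coefZ IH /project ext_delta coef_delta.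
have [->|bb'] := eqVneq b b'.
  by case: ifP; rewrite ?coef_delta ?eqxx // coef0 mulr0 addr0.
rewrite (_ : coef _ b = 0) ?mulr0 ?add0r //.
by case: ifP; rewrite ?coef0 // coef_delta (negPf bb').
Qed.

Lemma carried_project (P : pred B) (M : set B) c : carried M c ->
  carried [set b | M b /\ P b] (project P c).
Proof.
move=> Mc b; rewrite coef_project; case: ifP => [Pb /Mc//|_].
by rewrite eqxx.
Qed.

Lemma project_id (P : pred B) c : carried [set b | P b] c -> project P c = c.
Proof.
move=> Pc; apply: freeP => b; rewrite coef_project; case: ifPn => // nP.
by apply/esym/eqP; apply: contraNT nP; exact: Pc.
Qed.

Context (M : set B) (g : B -> nat) (D1 D2 D : {linear free A B -> free A B}).
Hypothesis DE : forall c, D c = D1 c + D2 c.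
Hypothesis DD : forall c, D (D c) = 0.
Hypothesis D1M : forall b, M b ->
  carried [set b' | M b' /\ g b' = g b] (D1 (delta A b)).
Hypothesis D2M : forall b, M b ->
  carried [set b' | M b' /\ (g b' < g b)%N] (D2 (delta A b)).
Hypothesis exact1 : forall n c, (0 < n)%N ->
  carried [set b | M b /\ g b = n] c -> D1 c = 0 ->
  exists2 d, carried [set b | M b /\ g b = n] d & D1 d = c.

(** Downward induction on the filtration degree [g]: the part of top degree of
    [c] is a cycle for the graded differential [D1], and subtracting the total
    boundary of a filling lowers the degree. *)
Lemma filtration c : carried M c -> carried [set b | g b = 0%N] (D c) ->
  exists2 d, carried M d & carried [set b | M b /\ g b = 0%N] (c - D d).
Proof.
suff H n c' : carried [set b | M b /\ (g b <= n)%N] c' ->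
    carried [set b | g b = 0%N] (D c') ->
    exists2 d, carried M d & carried [set b | M b /\ g b = 0%N] (c' - D d).
  move=> Mc; apply: (H (\max_(b <- supp c) g b)%N) => b cb; split.
    exact: Mc.
  by apply: (@leq_bigmax_seq _ _ xpredT g) => //; rewrite mem_supp.
elim: n c' => [|n IH] {}c Mc Dc.
  exists 0; first exact: carried0.
  rewrite linear0 subr0; apply: (carriedW Mc) => b [Mb].
  by rewrite leqn0 => /eqP.
pose P b := g b == n.+1.
have [cM cP] : carried [set b | M b /\ g b = n.+1] (project P c) /\
    carried [set b | M b /\ (g b <= n)%N] (c - project P c).
  split.
    by apply: (carriedW (carried_project Mc)) => b [[Mb _] /eqP].
  move=> b; rewrite coefD coefN coef_project; case: ifPn => [_|Pb].
    by rewrite subrr eqxx.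
  rewrite subr0 => /Mc[Mb gb]; split=> //.
  by rewrite -ltnS ltn_neqAle Pb.
have D1c : D1 (project P c) = 0.
  apply: freeP => b; rewrite coef0.
  have [gb|gb] := eqVneq (g b) n.+1; last first.
    have : carried [set b | g b = n.+1] (D1 (project P c)).
      apply: carried_lin cM => b' [Mb' gb']; apply: (carriedW (D1M Mb')).
      by move=> b'' /= [_ ->].
    by move=> /(_ b) /= h; apply/eqP; apply: contraNT gb => /h ->.
  have Dcb : coef (D c) b = 0.
    by apply/eqP; apply/negPn/negP => /Dc /=; rewrite gb.
  have low : carried [set b | (g b <= n)%N] (D2 (project P c) + D (c - project P c)).
    apply: carriedD.
      apply: carried_lin cM => b' [Mb' gb']; apply: (carriedW (D2M Mb')).
      by move=> b'' /= [_]; rewrite gb' ltnS.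
    rewrite DE; apply: carriedD; apply: carried_lin cP => b' [Mb' gb'].
      by apply: (carriedW (D1M Mb')) => b'' [_ /= ->].
    apply: (carriedW (D2M Mb')) => b'' [_ /= gb''].
    exact: leq_trans (ltnW gb'') gb'.
  have : coef (D2 (project P c) + D (c - project P c)) b = 0.
    by apply/eqP; apply/negPn/negP => /low /=; rewrite gb ltnn.
  have -> : D2 (project P c) + D (c - project P c) = D c - D1 (project P c).
    rewrite linearB /= (DE (project P c)) opprD [- D1 _ - _]addrC addrCA.
    by rewrite [D2 _ + _]addrA subrr add0r.
  by rewrite coefD coefN Dcb add0r => /eqP; rewrite oppr_eq0 => /eqP.
have [d dM dE] := exact1 (ltn0Sn n) cM D1c.
have [d' d'M d'E] : exists2 d', carried M d' &
    carried [set b | M b /\ g b = 0%N] (c - D d - D d').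
  apply: IH; last by rewrite linearB /= DD subr0.
  rewrite DE dE opprD addrA; apply: carriedB => //.
  apply: carried_lin dM => b [Mb gb]; apply: (carriedW (D2M Mb)) => b' [Mb'].
  by rewrite gb ltnS.
exists (d + d'); last by rewrite linearD opprD addrA.
by apply: carriedD => //; apply: (carriedW dM) => b [].
Qed.

End Filtration.

Section Bicomplex.
Context (A : pzRingType) (V I : choiceType).
Local Notation B := (seq V * seq I)%type.
Local Notation C1 := (free A (seq V)).
Local Notation C2 := (free A (seq I)).
Local Notation C := (free A B).

Definition row (t : seq I) : C1 -> C := ext (fun s => delta A (s, t)).
HB.instance Definition _ t := GRing.Linear.on (row t).
Definition column (s : seq V) : C2 -> C := ext (fun t => delta A (s, t)).
HB.instance Definition _ s := GRing.Linear.on (column s).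

Lemma row_delta t s : row t (delta A s) = delta A (s, t).
Proof. exact: ext_delta. Qed.
Lemma column_delta s t : column s (delta A t) = delta A (s, t).
Proof. exact: ext_delta. Qed.

Definition cone1 (v : V) : C -> C := ext (fun b => delta A (v :: b.1, b.2)).
HB.instance Definition _ v := GRing.Linear.on (cone1 v).

Lemma cone1_delta v s t : cone1 v (delta A (s, t)) = delta A (v :: s, t).
Proof. exact: ext_delta. Qed.

Lemma cone1_row v t c : cone1 v (row t c) = row t (cone v c).
Proof.
elim/free_ind: c => [|a s c IH]; first by rewrite !linear0.
by rewrite !linearP /= IH row_delta cone1_delta cone_delta row_delta.
Qed.

Lemma cone1_column v s c : cone1 v (column s c) = column (v :: s) c.
Proof.
elim/free_ind: c => [|a t c IH]; first by rewrite !linear0.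
by rewrite !linearP /= IH !column_delta cone1_delta.
Qed.

(** The total differential, defined by recursion on the first list so that
    [cone1 v] contracts it as [cone v] does for [bd]: its square is then zero
    without computing signs. Its two components appear in [total_bdE]. *)
Fixpoint total_simplex (s : seq V) (t : seq I) : C :=
  if s is v :: s' then delta A (s', t) - cone1 v (total_simplex s' t)
  else column [::] (bd (delta A t)).

Definition total_bd : C -> C := ext (fun b => total_simplex b.1 b.2).
HB.instance Definition _ := GRing.Linear.on total_bd.

Definition row_bd : C -> C := ext (fun b => row b.2 (bd (delta A b.1))).
HB.instance Definition _ := GRing.Linear.on row_bd.

Definition column_bd : C -> C :=
  ext (fun b => (-1) ^+ size b.1 *: column b.1 (bd (delta A b.2))).
HB.instance Definition _ := GRing.Linear.on column_bd.

Lemma total_bd_cone v c : total_bd (cone1 v c) = c - cone1 v (total_bd c).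
Proof.
elim/free_ind: c => [|a [s t] c IH]; first by rewrite !linear0 addr0.
rewrite !linearP /= IH cone1_delta /total_bd !ext_delta /=.
by rewrite scalerBr addrACA scalerN.
Qed.

Lemma total_bd_bd c : total_bd (total_bd c) = 0.
Proof.
elim/free_ind: c => [|a [s t] c IH]; first by rewrite !linear0.
rewrite !linearP /= IH addr0 -[RHS](scaler0 _ a); congr (_ *: _).
elim: s => [|v s IHs].
  rewrite [total_bd (delta _ _)]ext_delta /=.
  have H d : total_bd (column [::] d) = column [::] (bd d).
    elim/free_ind: d => [|a' t' d IHd]; first by rewrite !linear0.
    by rewrite !linearP /= IHd column_delta [total_bd (delta _ _)]ext_delta.
  by rewrite H bd_bd linear0.
rewrite -cone1_delta total_bd_cone linearB /= total_bd_cone IHs linear0 subr0.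
by rewrite subrr.
Qed.

Lemma total_bdE c : total_bd c = row_bd c + column_bd c.
Proof.
elim/free_ind: c => [|a [s t] c IH]; first by rewrite !linear0 addr0.
rewrite !linearP /= IH addrACA -scalerDr; congr (_ *: _ + _).
elim: s => [|v s IHs].
  by rewrite /total_bd /row_bd /column_bd !ext_delta /= bd_nil linear0 add0r scale1r.
rewrite -cone1_delta total_bd_cone IHs linearD cone1_delta.
rewrite /row_bd /column_bd !ext_delta /= linearZ /= cone1_row cone1_column.
by rewrite bd_cons linearB /= row_delta exprS mulN1r scaleNr opprD addrA.
Qed.

End Bicomplex.

Section BicomplexExact.
Context (A : pzRingType) (V I : choiceType).
Local Notation B := (seq V * seq I)%type.
Local Notation C1 := (free A (seq V)).
Local Notation C2 := (free A (seq I)).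
Local Notation C := (free A B).

Lemma row_bd_row (t : seq I) (c : C1) : row_bd (row t c) = row t (bd c).
Proof.
elim/free_ind: c => [|a s c IH]; first by rewrite !linear0.
by rewrite !linearP /= IH row_delta /row_bd ext_delta.
Qed.

Lemma total_bd_row (c : C1) : total_bd (row (I := I) [::] c) = row [::] (bd c).
Proof.
rewrite total_bdE row_bd_row; set x := column_bd _; suff -> : x = 0 by rewrite addr0.
rewrite {}/x; elim/free_ind: c => [|a s c IH]; first by rewrite !linear0.
rewrite !linearP /= IH row_delta /column_bd ext_delta /= bd_nil linear0.
by rewrite !scaler0 addr0.
Qed.

Lemma total_bd_column (c : C2) : total_bd (column (V := V) [::] c) = column [::] (bd c).
Proof.
elim/free_ind: c => [|a t c IH]; first by rewrite !linear0.
by rewrite !linearP /= IH column_delta /total_bd ext_delta.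
Qed.

Definition row_part (t : seq I) : C -> C1 :=
  ext (fun b => if b.2 == t then delta A b.1 else 0).
HB.instance Definition _ t := GRing.Linear.on (row_part t).

Definition column_part (s : seq V) : C -> C2 :=
  ext (fun b => if b.1 == s then delta A b.2 else 0).
HB.instance Definition _ s := GRing.Linear.on (column_part s).

Lemma row_part_delta t b :
  row_part t (delta A b) = if b.2 == t then delta A b.1 else 0.
Proof. exact: ext_delta. Qed.
Lemma column_part_delta s b :
  column_part s (delta A b) = if b.1 == s then delta A b.2 else 0.
Proof. exact: ext_delta. Qed.

Lemma row_partK t (c : C1) : row_part t (row t c) = c.
Proof.
elim/free_ind: c => [|a s c IH]; first by rewrite !linear0.
by rewrite !linearP /= IH row_delta row_part_delta eqxx.
Qed.

Lemma column_partK s (c : C2) : column_part s (column s c) = c.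
Proof.
elim/free_ind: c => [|a t c IH]; first by rewrite !linear0.
by rewrite !linearP /= IH column_delta column_part_delta eqxx.
Qed.

Lemma row_part_row (t t' : seq I) (c : C1) : row_part t (row t' c) = if t' == t then c else 0.
Proof.
case: eqP => [->|/eqP tt']; first exact: row_partK.
elim/free_ind: c => [|a s c IH]; first by rewrite !linear0.
by rewrite !linearP /= IH row_delta row_part_delta (negPf tt') scaler0 addr0.
Qed.

Lemma row_partE t (c : C) : carried [set b | b.2 = t] c -> row t (row_part t c) = c.
Proof.
move: c; apply: carried_ind => [|a [s t'] c /= -> IH]; first by rewrite !linear0.
by rewrite !linearP /= IH row_part_delta eqxx row_delta.
Qed.

Lemma column_partE s (c : C) :
  carried [set b | b.1 = s] c -> column s (column_part s c) = c.
Proof.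
move: c; apply: carried_ind => [|a [s' t] c /= -> IH]; first by rewrite !linear0.
by rewrite !linearP /= IH column_part_delta eqxx column_delta.
Qed.

Lemma bd_row_part t (c : C) : bd (row_part t c) = row_part t (row_bd c).
Proof.
elim/free_ind: c => [|a [s t'] c IH]; first by rewrite !linear0.
rewrite !linearP /= IH row_part_delta /row_bd ext_delta /= row_part_row.
by case: eqP => // _; rewrite linear0.
Qed.

Lemma row_decomposition (T : {fset seq I}) (c : C) :
  carried [set b | b.2 \in T] c -> c = \sum_(t <- T) row t (row_part t c).
Proof.
move: c; apply: carried_ind => [|a [s t] c /= tT IH].
  by rewrite big1 // => t _; rewrite !linear0.
rewrite [in LHS]IH.
under [RHS]eq_bigr do rewrite !linearP.
rewrite big_split /= -scaler_sumr; congr (_ *: _ + _).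
rewrite (bigD1_seq t) ?fset_uniq //= row_part_delta eqxx row_delta.
rewrite big1 ?addr0 // => t' tt'.
by rewrite row_part_delta eq_sym (negPf tt') linear0.
Qed.

(** A chain of the double complex is the finite sum of its rows, and each row can be
    filled separately. *)
Lemma row_exact (M : set B) n (c : C) :
  (forall t, size t = n -> acyclic A [set s | M (s, t)]) ->
  carried [set b | M b /\ size b.2 = n] c -> row_bd c = 0 ->
  exists2 d, carried [set b | M b /\ size b.2 = n] d & row_bd d = c.
Proof.
move=> acM Mc c0; pose T := [fset b.2 | b in supp c]%fset.
have cT : carried [set b | b.2 \in T] c.
  by move=> b cb; apply/imfsetP; exists b => //=; rewrite mem_supp.
have Tn t : t \in T -> size t = n.
  by move=> /imfsetP[b /= + ->]; rewrite mem_supp => /Mc[].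
have /choice[eta etaP] : forall t, exists y, t \in T ->
    carried [set s | M (s, t)] y /\ bd y = row_part t c.
  move=> t; have [tT|] := boolP (t \in T); last by exists 0.
  have [||y My yE] := acM t (Tn t tT) (row_part t c); last by exists y.
    apply: carried_lin Mc => -[s t'] [Mst _] /=; rewrite row_part_delta /=.
    case: eqP => [<-|_]; last exact: carried0.
    exact: carried_delta.
  by rewrite bd_row_part c0 linear0.
exists (\sum_(t <- T) row t (eta t)).
  apply: carried_sum => t tT; have [My _] := etaP t tT.
  apply: carried_lin My => s Mst /=; rewrite row_delta; apply: carried_delta.
  by split=> //; exact: Tn.
rewrite linear_sum [RHS](row_decomposition cT) big_seq [RHS]big_seq.
by apply: eq_bigr => t /etaP[_ yE]; rewrite /= row_bd_row yE.
Qed.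

Lemma column_bd_column (s : seq V) (c : C2) :
  column_bd (column s c) = (-1) ^+ size s *: column s (bd c).
Proof.
elim/free_ind: c => [|a t c IH]; first by rewrite !linear0 scaler0.
rewrite !linearP /= IH column_delta /column_bd ext_delta /= scalerDr !scalerA.
by rewrite commr_sign.
Qed.

Definition cone2 (i : seq V -> I) : C -> C :=
  ext (fun b => delta A (b.1, i b.1 :: b.2)).
HB.instance Definition _ i := GRing.Linear.on (cone2 i).

Lemma cone2_delta i s t : cone2 i (delta A (s, t)) = delta A (s, i s :: t).
Proof. exact: ext_delta. Qed.

Lemma cone2_column i s d : cone2 i (column s d) = column s (cone (i s) d).
Proof.
elim/free_ind: d => [|a t d IH]; first by rewrite !linear0.
by rewrite !linearP /= IH column_delta cone_delta column_delta cone2_delta.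
Qed.

(** [cone2 i] contracts the columns up to the sign of the column, which is constant
    when all first lists have length [n]. *)
Lemma column_exact (M : set B) (i : seq V -> I) n (c : C) :
  (forall s t, size s = n -> M (s, t) -> M (s, i s :: t)) ->
  carried [set b | M b /\ size b.1 = n] c -> column_bd c = 0 ->
  exists2 d, carried [set b | M b /\ size b.1 = n] d & column_bd d = c.
Proof.
move=> Mi Mc c0.
have HE : column_bd (cone2 i c) + cone2 i (column_bd c) = (-1) ^+ n *: c.
  move: Mc; move: c {c0}; apply: carried_ind => [|a [s t] c [_ /= sn] IH].
    by rewrite !linear0 scaler0 addr0.
  rewrite !linearP /= addrACA IH scalerDr; congr (_ + _).
  rewrite -scalerDr !scalerA -commr_sign -scalerA; congr (_ *: _).
  rewrite -column_delta cone2_column !column_bd_column linearZ /= cone2_column.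
  by rewrite -scalerDr sn -linearD /= bd_cone subrK.
exists ((-1) ^+ n *: cone2 i c).
  apply: carriedZ; apply: carried_lin Mc => -[s t] [Mst sn].
  by rewrite /= cone2_delta; apply: carried_delta; split=> //; exact: Mi.
move: HE; rewrite c0 linear0 addr0 linearZ /= => ->.
by rewrite scalerA -expr2 sqrr_sign scale1r.
Qed.

End BicomplexExact.

(** * The nerve of a cover *)

Section Nerve.
Context (A : pzRingType) (V I : choiceType) (K : complex V) (F : I -> complex V).
Hypothesis FK : forall i s, F i s -> K s.
Hypothesis cover : forall s, K s -> exists i, F i s.
Hypothesis F_acyclic : forall t : {fset I}, t != fset0 ->
  (exists s, inter F t s) -> acyclic A (ordered (inter F t)).

Local Notation B := (seq V * seq I)%type.
Local Notation C1 := (free A (seq V)).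
Local Notation C2 := (free A (seq I)).
Local Notation C := (free A B).

Definition incidence : set B := [set b | [/\ ordered K b.1,
  ordered (nerve F) b.2 & forall i, i \in b.2 -> ordered (F i) b.1]].

Lemma incidence_sub s t s' t' : incidence (s, t) ->
  subseq s' s -> subseq t' t -> incidence (s', t').
Proof.
move=> [/= Ks Nt Fst] ss tt; split=> /=.
- exact: ordered_face Ks ss.
- exact: ordered_face Nt tt.
- by move=> i it'; apply: ordered_face ss; apply: Fst; exact: (mem_subseq tt).
Qed.

Lemma row_bd_face s t : carried [set b : B |
  [/\ subseq b.1 s, (size b.1).+1 = size s & b.2 = t]] (row_bd (delta A (s, t))).
Proof.
rewrite /row_bd ext_delta; apply: carried_lin (@bd_face A V s) => s' [ss sn] /=.
by rewrite row_delta; exact: carried_delta.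
Qed.

Lemma column_bd_face s t : carried [set b : B |
  [/\ subseq b.2 t, (size b.2).+1 = size t & b.1 = s]]
  (column_bd (delta A (s, t))).
Proof.
rewrite /column_bd ext_delta; apply: carriedZ.
apply: carried_lin (@bd_face A I t) => t' [tt tn] /=.
by rewrite column_delta; exact: carried_delta.
Qed.

Lemma fset_seq_neq0 (T : choiceType) (t : seq T) :
  t != [::] -> [fset v in t]%fset != fset0.
Proof.
by case: t => // v t _; apply/fset0Pn; exists v; rewrite !inE eqxx.
Qed.

Lemma incidence_row_acyclic t : t != [::] ->
  acyclic A [set s | incidence (s, t)].
Proof.
move=> t0; have [Nt|Nt] := pselect (ordered (nerve F) t); last first.
  move=> c cM c0; exists 0; first exact: carried0.
  rewrite linear0; apply/esym/freeP => s; apply/eqP/negPn/negP => /cM[_ /=].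
  by [].
suff -> : [set s | incidence (s, t)] = ordered (inter F [fset i in t]%fset).
  apply: F_acyclic; first exact: fset_seq_neq0.
  by case: Nt t0 => [->//|[]].
apply/seteqP; split=> s; have [->|s0] := eqVneq s [::].
- by left.
- move=> [/= _ _ Fst]; right; split; first exact: fset_seq_neq0.
  by move=> i; rewrite inE => /Fst[sE|//]; rewrite sE in s0.
- by move=> _; split=> //; left.
- case=> [sE|[_ Fs]]; first by rewrite sE in s0.
  have Fst i : i \in t -> ordered (F i) s.
    by move=> it; right; apply: Fs; rewrite inE.
  split=> //; case: t t0 Fst {Nt Fs} => // i t _ Fst.
  by have [->|/FK Ks] := Fst i (mem_head _ _); [left|right].
Qed.

(** The index [i0] is only a default value for lists that span no simplex. *)
Lemma incidence_vertex (i0 : I) : exists i : seq V -> I, forall s t,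
  s != [::] -> incidence (s, t) -> incidence (s, i s :: t).
Proof.
suff /choice[i iP] : forall s : seq V, exists i, s != [::] -> ordered K s ->
    F i [fset v in s]%fset.
  exists i => s t s0 [/= Ks Nt Fst]; have Fis := iP s s0 Ks.
  have Fst' j : j \in i s :: t -> ordered (F j) s.
    by rewrite inE => /predU1P[->|/Fst//]; right.
  split=> //; right; split; first exact: fset_seq_neq0.
  exists [fset v in s]%fset; split=> [|j]; first exact: fset_seq_neq0.
  move=> jt; have /Fst'[sE|//] : j \in i s :: t by move: jt; rewrite !inE.
  by rewrite sE in s0.
move=> s; have [[sE|/cover[i Fi]]|nKs] := pselect (ordered K s).
- by exists i0; rewrite sE.
- by exists i.
- by exists i0.
Qed.

Lemma carried_row_bd (P : B -> Prop) s t : incidence (s, t) ->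
  (forall s', (size s').+1 = size s -> P (s', t)) ->
  carried [set b : B | incidence b /\ P b] (row_bd (delta A (s, t))).
Proof.
move=> st sP; apply: (carriedW (@row_bd_face s t)).
move=> [s' t'] /= [ss sn ->]; split; last exact: sP.
exact: incidence_sub st ss (subseq_refl t).
Qed.

Lemma carried_column_bd (P : B -> Prop) s t : incidence (s, t) ->
  (forall t', (size t').+1 = size t -> P (s, t')) ->
  carried [set b : B | incidence b /\ P b] (column_bd (delta A (s, t))).
Proof.
move=> st tP; apply: (carriedW (@column_bd_face s t)).
move=> [s' t'] /= [tt tn ->]; split; last exact: tP.
exact: incidence_sub st (subseq_refl s) tt.
Qed.

Lemma incidence_to_row (c : C) : carried incidence c ->
  carried [set b | size b.2 = 0%N] (total_bd c) ->
  exists2 d, carried incidence d &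
    carried [set b | incidence b /\ size b.2 = 0%N] (c - total_bd d).
Proof.
move=> Mc c0; apply: (@filtration A B incidence (fun b => size b.2)
  (@row_bd A V I) (@column_bd A V I) (@total_bd A V I) _ _ _ _ _ c Mc c0).
- exact: total_bdE.
- exact: total_bd_bd.
- by move=> [s t] st; apply: carried_row_bd.
- by move=> [s t] st; apply: carried_column_bd => //= t' <-.
- move=> n c' n0; apply: row_exact => t tn; apply: incidence_row_acyclic.
  by rewrite -size_eq0 tn -lt0n.
Qed.

Lemma incidence_to_column (c : C) : carried incidence c ->
  carried [set b | size b.1 = 0%N] (total_bd c) ->
  exists2 d, carried incidence d &
    carried [set b | incidence b /\ size b.1 = 0%N] (c - total_bd d).
Proof.
move=> Mc c0; apply: (@filtration A B incidence (fun b => size b.1)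
  (@column_bd A V I) (@row_bd A V I) (@total_bd A V I) _ _ _ _ _ c Mc c0).
- by move=> b; rewrite addrC; exact: total_bdE.
- exact: total_bd_bd.
- by move=> [s t] st; apply: carried_column_bd.
- by move=> [s t] st; apply: carried_row_bd => //= s' <-.
- move=> n c' n0 Mc' c'0.
  have [[[s t] /Mc'[[/= Ks _ _] sn]]|nc] := pselect (exists b, coef c' b != 0).
    have [i0 _] : exists i : I, True.
      case: Ks sn => [-> n0'|/cover[i _] _]; last by exists i.
      by rewrite -n0' in n0.
    have [i iP] := incidence_vertex i0.
    apply: (column_exact (i := i)) Mc' c'0 => s' t' s'n; apply: iP.
    by rewrite -size_eq0 s'n -lt0n.
  exists 0; first exact: carried0.
  rewrite linear0; apply/esym/freeP => b; apply/eqP/negPn/negP => cb.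
  by apply: nc; exists b.
Qed.

Definition degree (b : B) := (size b.1 + size b.2)%N.

(** Used to replace a filling of a homogeneous chain by its part of the right
    degree. *)
Lemma total_bd_project n (c : C) : total_bd (project (fun b => degree b == n.+1) c) =
  project (fun b => degree b == n) (total_bd c).
Proof.
elim/free_ind: c => [|a [s t] c IH]; first by rewrite !linear0.
rewrite !linearP /= IH; congr (_ *: _ + _).
have : carried [set b : B | (degree b).+1 = degree (s, t)]
    (total_bd (delta A (s, t))).
  rewrite total_bdE; apply: carriedD.
    by apply: (carriedW (@row_bd_face s t)) => b [_ sn bt];
      rewrite /degree /= -sn bt.
  by apply: (carriedW (@column_bd_face s t)) => b [_ sn bt];
      rewrite /degree /= -sn bt addnS.
rewrite {1}/project ext_delta; case: eqP => [-> st|bn st].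
  rewrite project_id //; apply: (carriedW st) => b /= /succn_inj ->.
  exact: eqxx.
rewrite linear0; apply/esym/freeP => b; rewrite coef_project coef0.
case: eqP => // bE; apply/eqP/negPn/negP => /st /=.
by rewrite bE => /esym.
Qed.

End Nerve.

(** Cycles for unreduced homology: in degree zero the boundary is a multiple of the
    empty list, in positive degree it has to vanish. *)
Definition ordered_cycle (A : pzRingType) (V : choiceType) (K : complex V) n
    (z : free A (seq V)) :=
  [/\ carried (ordered K) z, carried [set t | size t = n.+1] z &
      carried [set [::]] (bd z)].

Section NerveHomology.
Context (A : pzRingType) (V I : choiceType) (K : complex V) (F : I -> complex V).
Hypothesis FK : forall i s, F i s -> K s.
Hypothesis cover : forall s, K s -> exists i, F i s.
Hypothesis F_acyclic : forall t : {fset I}, t != fset0 ->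
  (exists s, inter F t s) -> acyclic A (ordered (inter F t)).
Local Notation row0 := (row ([::] : seq I)).
Local Notation column0 := (column ([::] : seq V)).
Local Notation M := (incidence K F).

Lemma incidence_row0 (z : free A (seq V)) :
  carried (ordered K) z -> carried M (row0 z).
Proof.
apply: carried_lin => t Kt /=; rewrite row_delta; apply: carried_delta.
by split=> //; left.
Qed.

Lemma incidence_column0 (w : free A (seq I)) :
  carried (ordered (nerve F)) w -> carried M (column0 w).
Proof.
apply: carried_lin => t Nt /=; rewrite column_delta; apply: carried_delta.
by split=> //; left.
Qed.

(** Exactness of the columns moves [z], up to a boundary, to the edge of empty
    first lists; the homogeneous part [d'] of the filling keeps the degree. *)
Lemma row0_homologous n (z : free A (seq V)) : ordered_cycle K n z ->
  exists2 w, ordered_cycle (nerve F) n w &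
  exists2 b, carried M b & total_bd b = row0 z - column0 w.
Proof.
move=> [Kz zn z0].
have [|d Md dE] := incidence_to_column cover (incidence_row0 Kz).
  rewrite total_bd_row; apply: carried_lin z0 => t -> /=.
  by rewrite row_delta; exact: carried_delta.
pose d' := project (fun b => degree b == n.+2) d.
have Md' : carried M d' by apply: (carriedW (carried_project Md)) => b [].
have dE' : carried [set b | [/\ M b, size b.1 = 0%N & degree b = n.+1]]
    (row0 z - total_bd d').
  have -> : row0 z - total_bd d' =
      project (fun b => degree b == n.+1) (row0 z - total_bd d).
    rewrite linearB /= -total_bd_project project_id //.
    apply: carried_lin zn => t tn /=; rewrite row_delta; apply: carried_delta.
    by rewrite /degree /= addn0 tn.
  by apply: (carriedW (carried_project dE)) => b [[Mb b0] /eqP bn].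
pose w := column_part [::] (row0 z - total_bd d').
have wE : column0 w = row0 z - total_bd d'.
  by apply: column_partE; apply: (carriedW dE') => b [_ /size0nil].
have bw : column0 (bd w) = row0 (bd z).
  by rewrite -total_bd_column wE linearB /= total_bd_bd subr0 total_bd_row.
exists w; last by exists d' => //; rewrite wE opprB addrC subrK.
split.
- apply: carried_lin dE' => -[s t] [[_ /= Nt _] _ _]; rewrite column_part_delta.
  by case: ifP => _; [exact: carried_delta|exact: carried0].
- apply: carried_lin dE' => -[s t] [_ /= s0 ]; rewrite /degree /= s0 add0n => tn.
  rewrite column_part_delta.
  by case: ifP => _; [exact: carried_delta|exact: carried0].
- rewrite -(column_partK ([::] : seq V) (bd w)) bw.
  have r0 : carried [set ([::], [::])] (row0 (bd z)).
    apply: carried_lin z0 => t -> /=; rewrite row_delta; exact: carried_delta.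
  apply: carried_lin r0 => b -> /=; rewrite column_part_delta eqxx.
  exact: carried_delta.
Qed.

Lemma column0_homologous n (w : free A (seq I)) : ordered_cycle (nerve F) n w ->
  exists2 z, ordered_cycle K n z &
  exists2 b, carried M b & total_bd b = row0 z - column0 w.
Proof.
move=> [Nw wn w0].
have [|d Md dE] := incidence_to_row FK F_acyclic (incidence_column0 Nw).
  rewrite total_bd_column; apply: carried_lin w0 => t -> /=.
  by rewrite column_delta; exact: carried_delta.
pose d' := project (fun b => degree b == n.+2) d.
have Md' : carried M d' by apply: (carriedW (carried_project Md)) => b [].
have dE' : carried [set b | [/\ M b, size b.2 = 0%N & degree b = n.+1]]
    (column0 w - total_bd d').
  have -> : column0 w - total_bd d' =
      project (fun b => degree b == n.+1) (column0 w - total_bd d).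
    rewrite linearB /= -total_bd_project project_id //.
    apply: carried_lin wn => t tn /=; rewrite column_delta.
    by apply: carried_delta; rewrite /degree /= add0n tn.
  by apply: (carriedW (carried_project dE)) => b [[Mb b0] /eqP bn].
pose z := row_part [::] (column0 w - total_bd d').
have zE : row0 z = column0 w - total_bd d'.
  by apply: row_partE; apply: (carriedW dE') => b [_ /size0nil].
have bz : row0 (bd z) = column0 (bd w).
  by rewrite -total_bd_row zE linearB /= total_bd_bd subr0 total_bd_column.
exists z; last first.
  by exists (- d'); [exact: carriedN|rewrite linearN /= zE addrAC subrr add0r].
split.
- apply: carried_lin dE' => -[s t] [[/= Ks _ _] _ _]; rewrite row_part_delta.
  by case: ifP => _; [exact: carried_delta|exact: carried0].
- apply: carried_lin dE' => -[s t] [_ /= t0 ]; rewrite /degree /= t0 addn0 => sn.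
  rewrite row_part_delta.
  by case: ifP => _; [exact: carried_delta|exact: carried0].
- rewrite -(row_partK ([::] : seq I) (bd z)) bz.
  have c0 : carried [set ([::], [::])] (column0 (bd w)).
    apply: carried_lin w0 => t -> /=; rewrite column_delta.
    exact: carried_delta.
  apply: carried_lin c0 => b -> /=; rewrite row_part_delta eqxx.
  exact: carried_delta.
Qed.

(** Moving [b] to the edge changes it by a boundary, so the edge part of [b] still
    bounds [z]. *)
Lemma row0_boundary (z : free A (seq V)) b : carried M b -> total_bd b = row0 z ->
  exists2 y, carried (ordered K) y & bd y = z.
Proof.
move=> Mb bE; have [|d Md dE] := incidence_to_row FK F_acyclic Mb.
  rewrite bE; apply: (@carried_lin _ _ _ setT) => // s _ /=.
  by rewrite row_delta; exact: carried_delta.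
pose y := row_part [::] (b - total_bd d).
have yE : row0 y = b - total_bd d.
  by apply: row_partE; apply: (carriedW dE) => b' [_ /size0nil].
exists y; last first.
  rewrite -(row_partK ([::] : seq I) z) -bE -(row_partK ([::] : seq I) (bd y)).
  rewrite -total_bd_row yE; by rewrite linearB /= total_bd_bd subr0.
apply: carried_lin dE => -[s t] [[/= Ks _ _] _]; rewrite row_part_delta.
by case: ifP => _; [exact: carried_delta|exact: carried0].
Qed.

Lemma column0_boundary (w : free A (seq I)) b : carried M b -> total_bd b = column0 w ->
  exists2 y, carried (ordered (nerve F)) y & bd y = w.
Proof.
move=> Mb bE; have [|d Md dE] := incidence_to_column cover Mb.
  rewrite bE; apply: (@carried_lin _ _ _ setT) => // t _ /=.
  by rewrite column_delta; exact: carried_delta.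
pose y := column_part [::] (b - total_bd d).
have yE : column0 y = b - total_bd d.
  by apply: column_partE; apply: (carriedW dE) => b' [_ /size0nil].
exists y; last first.
  rewrite -(column_partK ([::] : seq V) w) -bE -(column_partK ([::] : seq V) (bd y)).
  by rewrite -total_bd_column yE linearB /= total_bd_bd subr0.
apply: carried_lin dE => -[s t] [[/= _ Nt _] _]; rewrite column_part_delta.
by case: ifP => _; [exact: carried_delta|exact: carried0].
Qed.

End NerveHomology.

(** * Persistent homology *)

Section OrientedCycles.
Context (A : pzRingType) (V : choiceType).
Implicit Types (K : complex V) (z : free A (seq V)).

Lemma ordered_cycle_lin K n a z z' : ordered_cycle K n z -> ordered_cycle K n z' ->
  ordered_cycle K n (a *: z + z').
Proof.
move=> [Kz zn z0] [Kz' z'n z'0]; split; rewrite ?linearP /=;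
  by apply: carriedD => //; exact: carriedZ.
Qed.

Lemma orient_cycle K n z : ordered_cycle K n z -> Defs.cycle K (orient n z).
Proof.
move=> [Kz zn z0]; split; first exact: orient_chain.
case: n zn => // n _; rewrite boundary_orient.
pose o : {linear free A (seq V) -> n.+1.-tuple V -> A^o} := \0.
by rewrite (eq_lin (g := o) _ z0) // => t ->; rewrite /= orient_size.
Qed.

Lemma cycle_orient K n (c : n.+1.-tuple V -> A^o) : Defs.cycle K c ->
  exists2 z, ordered_cycle K n z & orient n z = c.
Proof.
have [r [rtot ranti rtr]] := total_order_exists V.
move=> [Kc c0]; have Kp := carried_increasing_part (r := r) Kc.
exists (increasing_part r c); last exact: (orient_increasing_part rtot ranti rtr Kc).
have pn : carried [set t | size t = n.+1] (increasing_part r c).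
  by apply: (carriedW Kp) => t [].
split=> //; first by apply: (carriedW Kp) => t [].
case: n c Kc c0 Kp pn => [|n] c Kc c0 _ pn.
  by apply: (carriedW (bd_size pn)) => t /size0nil.
rewrite (bd_increasing_part rtot ranti rtr Kc) c0 increasing_part0.
exact: carried0.
Qed.

(** From right to left, [orient] is a chain map. Conversely, if [orient n z] bounds,
    so does its increasing part, which is homologous to [z] by
    [straighten_homotopy]. *)
Lemma orient_boundaryP K n z : ordered_cycle K n z ->
  is_boundary K (orient n z) <-> exists2 y, carried (ordered K) y & bd y = z.
Proof.
have [r [rtot ranti rtr]] := total_order_exists V.
move=> [Kz zn z0]; split=> [[b Kb bE]|[y Ky yE]]; last first.
  exists (orient n.+1 y); first exact: (@orient_chain A V K n.+1 y Ky).
  by rewrite boundary_orient yE.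
have [e Ke eE] := straighten_homotopy rtot ranti rtr Kz z0.
exists (e + increasing_part r b).
  apply: carriedD => //.
  by apply: (carriedW (carried_increasing_part (r := r) Kb)) => t [].
rewrite linearD /= eE (straighten_orient r zn) -bE.
by rewrite (bd_increasing_part rtot ranti rtr Kb) subrK.
Qed.

End OrientedCycles.

Section QuotientIso.
Context (A : pzRingType).

Section Projection.
Context (M : lmodType A) (N : submodClosed M).

Definition quot_proj (x : M) : quot_lmod N :=
  (\pi_({ideal_quot (submod_pred N)})%qT x).

Lemma quot_projP a x y :
  quot_proj (a *: x + y) = a *: quot_proj x + quot_proj y.
Proof.
rewrite -[a *: quot_proj x]/(quot_scale a (quot_proj x)) /quot_proj.
rewrite quot_scale_pi.
exact: raddfD.
Qed.

Lemma quot_proj_eq x y : quot_proj x = quot_proj y <-> x - y \in N.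
Proof.
rewrite -[x - y \in N]/(x - y \in submod_pred N).
rewrite ring_quotient.Quotient.idealrBE; split=> [/eqP//|/eqP//].
Qed.

Lemma quot_proj_surj q : exists x, quot_proj x = q.
Proof.
by exists (repr (q : {ideal_quot (submod_pred N)})); rewrite /quot_proj reprK.
Qed.

End Projection.

(** A linear correspondence, defined everywhere and onto, that relates elements of
    [N1] exactly to elements of [N2] is the graph of an isomorphism between the
    quotients. *)
Lemma correspondence_iso (M1 M2 : lmodType A) (N1 : submodClosed M1)
    (N2 : submodClosed M2) (E : M1 -> M2 -> Prop) :
  (forall a x y x' y', E x x' -> E y y' -> E (a *: x + y) (a *: x' + y')) ->
  (forall x, exists x', E x x') -> (forall x', exists x, E x x') ->
  (forall x x', E x x' -> x \in N1 <-> x' \in N2) ->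
  exists f : {linear quot_lmod N1 -> quot_lmod N2}, bijective f.
Proof.
move=> Elin Etot Esurj EN.
have EB x y x' y' : E x x' -> E y y' ->
    quot_proj N1 x = quot_proj N1 y <-> quot_proj N2 x' = quot_proj N2 y'.
  move=> xx' yy'; rewrite !quot_proj_eq; apply: EN.
  rewrite -[- y]scaleN1r -[- y']scaleN1r [x + _]addrC [x' + _]addrC.
  exact: Elin.
have /choice[f fP] : forall q, exists q', exists x x',
    [/\ quot_proj N1 x = q, quot_proj N2 x' = q' & E x x'].
  move=> q; have [x xq] := quot_proj_surj q; have [x' xx'] := Etot x.
  by exists (quot_proj N2 x'), x, x'.
have fE x x' : E x x' -> f (quot_proj N1 x) = quot_proj N2 x'.
  move=> xx'; have [y [y' [yx <- yy']]] := fP (quot_proj N1 x).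
  by apply/(EB _ _ _ _ yy' xx').
have f_lin : linear f.
  move=> a q1 q2; have [x [x' [<- <- xx']]] := fP q1.
  have [y [y' [<- <- yy']]] := fP q2.
  by rewrite -!quot_projP; apply: fE; exact: Elin.
pose fl : {linear quot_lmod N1 -> quot_lmod N2} :=
  HB.pack f (GRing.isLinear.Build _ _ _ _ f f_lin).
exists fl.
have /choice[g gP] : forall q', exists q, f q = q'.
  move=> q'; have [x' <-] := quot_proj_surj q'; have [x xx'] := Esurj x'.
  by exists (quot_proj N1 x); exact: fE.
exists g => q; last exact: gP.
have [x [x' [xq x'q xx']]] := fP q; have [y [y' [yq y'q yy']]] := fP (g (f q)).
have : quot_proj N1 y = quot_proj N1 x.
  by apply/(EB _ _ _ _ yy' xx'); rewrite y'q x'q gP.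
by rewrite xq yq.
Qed.

End QuotientIso.

Section PersistentNerve.
Context (A : pzRingType) (V I : choiceType) (K L : complex V)
  (F G : I -> complex V).
Hypothesis KL : forall s, K s -> L s.
Hypothesis FG : forall i s, F i s -> G i s.
Hypothesis FK : forall i s, F i s -> K s.
Hypothesis GL : forall i s, G i s -> L s.
Hypothesis F_cover : forall s, K s -> exists i, F i s.
Hypothesis G_cover : forall s, L s -> exists i, G i s.
Hypothesis F_acyclic : forall t : {fset I}, t != fset0 ->
  (exists s, inter F t s) -> acyclic A (ordered (inter F t)).
Hypothesis G_acyclic : forall t : {fset I}, t != fset0 ->
  (exists s, inter G t s) -> acyclic A (ordered (inter G t)).

Lemma ordered_mono (T : choiceType) (X Y : complex T) t :
  (forall s, X s -> Y s) -> ordered X t -> ordered Y t.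
Proof. by move=> XY [->|/XY]; [left|right]. Qed.

Lemma nerve_mono s : nerve F s -> nerve G s.
Proof.
move=> [s0 [t [t0 Ft]]]; split=> //; exists t; split=> // i si.
by apply: FG; exact: Ft.
Qed.

Lemma incidence_mono : incidence K F `<=` incidence L G.
Proof.
move=> b [Kb Nb Fb]; split; [exact: ordered_mono Kb| |].
  exact: ordered_mono nerve_mono Nb.
by move=> i /Fb; apply: ordered_mono => s; exact: FG.
Qed.

(** The cycles of [K] and of the nerve of [F] are put in correspondence by the
    double complex of [G]: the filling exists already in that of [F], and the
    larger one decides which cycles bound. *)
Theorem persistent_nerve n :
  exists f : {linear persistent_homology A K L n ->
    persistent_homology A (nerve F) (nerve G) n}, bijective f.
Proof.
pose E (x : cycle_module A K n) (x' : cycle_module A (nerve F) n) :=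
  exists z w b, [/\ ordered_cycle K n z /\ orient n z = val x,
    ordered_cycle (nerve F) n w /\ orient n w = val x', carried (incidence L G) b &
    total_bd b = row [::] z - column [::] w].
apply: (@correspondence_iso A _ _ _ _ E).
- move=> a x y x' y' [z [w [b [[zc zx] [wc wx'] bM bE]]]].
  move=> [z' [w' [b' [[z'c z'y] [w'c w'y'] b'M b'E]]]].
  exists (a *: z + z'), (a *: w + w'), (a *: b + b'); split.
  + split; first exact: ordered_cycle_lin.
    by rewrite linearP /= zx z'y.
  + split; first exact: ordered_cycle_lin.
    by rewrite linearP /= wx' w'y'.
  + by apply: carriedD => //; exact: carriedZ.
  + by rewrite !linearP /= bE b'E scalerDr addrACA.
- move=> x; have /cyclesP xc := valP x.
  have [z zc zx] := cycle_orient xc.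
  have [w wc [b bM bE]] := row0_homologous F_cover zc.
  have w_c : orient n w \in @cycles A _ (nerve F) n.
    by apply/cyclesP; exact: orient_cycle.
  exists (exist (fun c : n.+1.-tuple I -> A^o =>
    c \in @cycles A _ (nerve F) n) _ w_c), z, w, b; split=> //.
  by apply: (carriedW bM); exact: incidence_mono.
- move=> x'; have /cyclesP x'c := valP x'.
  have [w wc wx'] := cycle_orient x'c.
  have [z zc [b bM bE]] := column0_homologous FK F_acyclic wc.
  have z_c : orient n z \in @cycles A _ K n.
    by apply/cyclesP; exact: orient_cycle.
  exists (exist (fun c : n.+1.-tuple V -> A^o =>
    c \in @cycles A _ K n) _ z_c), z, w, b; split=> //.
  by apply: (carriedW bM); exact: incidence_mono.
- move=> x x' [z [w [b [[[Kz zn z0] zx] [[Nw wn w0] wx'] bM bE]]]].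
  have zc : ordered_cycle L n z.
    by split=> //; apply: (carriedW Kz) => t; exact: ordered_mono.
  have wc : ordered_cycle (nerve G) n w.
    split=> //; apply: (carriedW Nw) => t; apply: ordered_mono.
    exact: nerve_mono.
  split=> /boundingP; rewrite -?zx -?wx'.
    move=> /(orient_boundaryP zc)[y Ly yz].
    apply/boundingP; rewrite -wx'; apply/(orient_boundaryP wc).
    apply: (column0_boundary G_cover (b := row [::] y - b)).
      by apply: carriedB => //; exact: incidence_row0.
    by rewrite linearB /= total_bd_row yz bE opprB addrC subrK.
  move=> /(orient_boundaryP wc)[y Ny yw].
  apply/boundingP; rewrite -zx; apply/(orient_boundaryP zc).
  apply: (row0_boundary GL G_acyclic (b := b + column [::] y)).
    by apply: carriedD => //; exact: incidence_column0.
  by rewrite linearD /= total_bd_column yw bE subrK.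
Qed.

End PersistentNerve.

Theorem proposition1 (R : realType) (A : pzRingType)
  (W : choiceType) (Delta : complex W)
  (J : set R) (D : R -> simplicial_subspace R (realization R Delta))
  (I : choiceType) (F : R -> I -> complex (realization R Delta))
  (filtration : forall l l', J l -> J l' -> l < l' ->
    underlying (D l) `<=` underlying (D l'))
  (F_sub : forall l i, J l -> simplex (F l i) `<=` simplex (D l))
  (F_locally_finite : forall l v, J l -> D l [fset v]%fset ->
    finite_set [set i | F l i [fset v]%fset])
  (F_cover : forall l, J l ->
    simplex (D l) = \bigcup_(i in [set: I]) simplex (F l i))
  (F_contractible : forall l (s : {fset I}), J l -> s != fset0 ->
    (exists t, inter (F l) s t) ->
    contractible R (realization R (inter (F l) s)))
  (l p : R) (Jl : J l) (Jlp : J (l + p)) (p_gt0 : 0 < p)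
  (F_subcomplex : forall i,
    subcomplex (D l) (D (l + p)) (F l i) (F (l + p) i))
  (k : nat) :
  exists f : {linear persistent_homology A (D l) (D (l + p)) k ->
                     persistent_homology A (nerve (F l)) (nerve (F (l + p))) k},
    bijective f.
Proof.
have cover l' : J l' -> forall s, D l' s -> exists i, F l' i s.
  move=> Jl' s Ds; have : simplex (D l') s by [].
  by rewrite F_cover // => -[i _ Fs]; exists i.
have FG i s : F l i s -> F (l + p) i s by move=> /F_subcomplex[].
apply: persistent_nerve => //.
- by move=> s /(cover l Jl)[i /FG]; exact: F_sub.
- by move=> i; exact: F_sub.
- by move=> i; exact: F_sub.
- exact: cover.
- exact: cover.
- by move=> t t0 tF; apply: contractible_acyclic; exact: F_contractible.
- by move=> t t0 tF; apply: contractible_acyclic; exact: F_contractible.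
Qed.
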